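(* Let $b\geq 2$ be an integer. For each pair $(i,j)\in\mathbb{N}\times\mathbb{N}_{\geq 2}$ let $d_{i,j},h_{i,j}$ be relatively prime positive integers, let $S_{i,j}\subseteq\mathbb{N}$ be an infinite set containing every prime number $p$ with $p\equiv h_{i,j}\pmod{d_{i,j}}$, and let $a_{i,j}:S_{i,j}\to\mathbb{Z}\setminus\{0\}$ be a bounded function. Then the set consisting of the number $1$ together with the numbers \[ f_{i,j}(1/b)=\sum_{n\in S_{i,j}}\frac{a_{i,j}(n)}{b^{in^j}},\qquad (i,j)\in\mathbb{N}\times\mathbb{N}_{\geq 2}, \] is linearly independent over $\mathbb{Q}$ (i.e., every finite subset of it is linearly independent over $\mathbb{Q}$).
   Context: $\mathbb{N}$ denotes the set of positive integers and $\mathbb{N}_{\geq 2}=\{2,3,\dots\}$. An infinite set of numbers is called linearly independent over $\mathbb{Q}$ if each of its finite subsets is linearly independent over $\mathbb{Q}$. The function $f_{i,j}(z)=\sum_{n\in S_{i,j}}a_{i,j}(n)z^{in^j}$. *)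

(* Defs.v *)
From mathcomp Require Export all_boot all_order all_algebra.
From mathcomp Require Export all_classical all_reals all_analysis.

Set Implicit Arguments.
Unset Strict Implicit.
Unset Printing Implicit Defensive.

Import Order.TTheory GRing.Theory Num.Theory.
Import numFieldNormedType.Exports.

Local Open Scope classical_set_scope.
Local Open Scope ring_scope.

(* Linear independence of a set of numbers, not of an indexed family: finite
   subsets are the duplicate-free sequences [s] of elements of [A]. *)
Definition rat_lin_indep (R : realType) (A : set R) : Prop :=
  forall s : seq R, uniq s -> [set` s] `<=` A ->
  forall c : R -> rat, \sum_(x <- s) ratr (c x) * x = 0 ->
  forall x, x \in s -> c x = 0.

(* Only the values of [a] on [S] matter. [limn] is meaningful only when the
   series converges, e.g. when [a] is bounded on [S], 0 < i, 0 < j and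
   `|z| < 1. *)
Definition sparse_series (R : realType) (S : set nat) (a : nat -> int)
    (i j : nat) (z : R) : R :=
  limn (fun N : nat => \sum_(0 <= n < N | n \in S) (a n)%:~R * z ^+ (i * n ^ j)).

(* Main.v *)
Require Import Defs.
From mathcomp Require Import cyclic zify ring lra.

(* Clear denominators in a rational relation and collect the terms b^-m. If an
   exponent m is isolated, with long enough gaps on both sides, then truncating
   the relation in either gap leaves an integer of absolute value less than 1,
   so that the coefficient of b^-m vanishes. Take (i, j) with j, then i, minimal
   among the pairs occurring, and m = i p^j with p a large prime: by unique
   factorization no other pair contributes to m. To isolate m, choose for each
   c != 0 with |c| <= K and each i' a prime q and a residue r with q exactly
   dividing i r^j + c; then i p^j + c = i' n^j' is impossible for p = r modulo
   q^2, as j' >= 2. By the Chinese remainder theorem everything reduces to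
   Dirichlet's theorem on primes in arithmetic progressions.

   Dirichlet's theorem is proved without complex characters. For g periodic
   modulo d and of mean zero on the invertible residues let
   (Lg)(m) = \sum_n g(mn) / n. Then \sum_(n <= N) Lambda(n) (Lg)(n) / n = O(1),
   while \sum_(n <= N) Lambda(n) g(n) / n = - g(1) ln N + O(1) if Lg = 0. Hence
   the kernel and the image of L are complementary, and positivity of Lambda
   bounds the diagonal of the projection onto the kernel, whose trace is at
   most 1. A nonzero kernel would thus be a line spanned by a real character
   chi with \sum_n chi(n) / n = 0, which Monsky's argument excludes; so L is
   invertible and every invertible class has logarithmic density 1 / phi(d). *)

Set Implicit Arguments.
Unset Strict Implicit.
Unset Printing Implicit Defensive.

Import Order.TTheory GRing.Theory Num.Theory.
Import numFieldNormedType.Exports.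

Local Open Scope classical_set_scope.
Local Open Scope ring_scope.

(** * Divisor sums *)

Definition divisor_sum (V : zmodType) (F : nat -> V) (n : nat) : V :=
  \sum_(1 <= e < n.+1 | (e %| n)%N) F e.

Lemma eq_divisor_sum (V : zmodType) (F G : nat -> V) n :
  (forall e, (0 < e)%N -> (e %| n)%N -> F e = G e) ->
  divisor_sum F n = divisor_sum G n.
Proof.
move=> FG; rewrite /divisor_sum big_nat_cond [RHS]big_nat_cond.
by apply: eq_bigr => e /andP[/andP[e0 _] en]; apply: FG.
Qed.

Lemma sum_multiples (V : zmodType) (G : nat -> V) m N : (0 < m)%N ->
  \sum_(1 <= n < N.+1 | (m %| n)%N) G (n %/ m)%N =
  \sum_(1 <= k < (N %/ m).+1) G k.
Proof.
move=> m0; elim: N => [|N IH]; first by rewrite div0n !big_geq.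
rewrite big_mkcond big_nat_recr// -big_mkcond IH divnS//.
rewrite [LHS]/=; case: ifP => mN; last by rewrite addr0 add0n.
by rewrite [RHS]big_nat_recr// mN.
Qed.

(** Both sides run over the pairs (e, k) with e k <= N, grouped by the product on the left and by e
    on the right. *)
Lemma sum_divisor_sum (V : zmodType) (F : nat -> nat -> V) N :
  \sum_(1 <= n < N.+1) divisor_sum (fun e => F e (n %/ e)%N) n =
  \sum_(1 <= e < N.+1) \sum_(1 <= k < (N %/ e).+1) F e k.
Proof.
transitivity (\sum_(1 <= n < N.+1)
    \sum_(1 <= e < N.+1 | (e %| n)%N) F e (n %/ e)%N).
  apply: eq_big_nat => n /andP[n0 nN]; rewrite /divisor_sum.
  rewrite [RHS](@big_cat_nat _ _ _ n.+1)//=.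
  rewrite [X in _ = _ + X]big_nat_cond [X in _ = _ + X]big1 ?addr0// => e.
  by move=> /andP[/andP[ne _]] /(dvdn_leq n0); lia.
rewrite (exchange_big_dep_nat xpredT)//=.
by apply: eq_big_nat => e /andP[e0 _]; rewrite sum_multiples.
Qed.

(** The divisors of p^(k+1) m that are prime to p are those of m; the others are p times the
    divisors of p^k m. *)
Lemma divisor_sum_pfactor (V : zmodType) (F : nat -> V) p k m :
    prime p -> ~~ (p %| m)%N -> (0 < m)%N ->
  divisor_sum F (p ^ k.+1 * m)%N =
  divisor_sum F m + divisor_sum (fun e => F (p * e)%N) (p ^ k * m)%N.
Proof.
move=> pp pm m0.
have p0 : (0 < p)%N by exact: prime_gt0.
have pk0 j : (0 < p ^ j)%N by rewrite expn_gt0 p0.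
rewrite {1}/divisor_sum (bigID (fun e => p %| e)%N)/= addrC; congr (_ + _).
  rewrite /divisor_sum [LHS](@big_cat_nat _ _ _ m.+1)//=; last first.
    by rewrite ltnS leq_pmull.
  rewrite [X in _ + X]big_nat_cond [X in _ + X]big1 ?addr0; last first.
    move=> e /andP[/andP[me _]] /andP[en pe].
    move: en; rewrite Gauss_dvdr; first by move=> /(dvdn_leq m0); lia.
    by rewrite coprimeXr// coprime_sym prime_coprime.
  apply: eq_bigl => e; apply/andP/idP => [[en pe]|em].
    by move: en; rewrite Gauss_dvdr// coprimeXr// coprime_sym prime_coprime.
  split; first exact: dvdn_mull.
  by apply: contra pm => /dvdn_trans; apply.
have := sum_multiples (fun e => if (p * e %| p ^ k.+1 * m)%N then F (p * e)%N else 0)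
  (p ^ k.+1 * m)%N p0.
rewrite [in (_ %/ p)%N]expnS -[in (_ %/ p)%N]mulnA mulKn// => H.
rewrite /divisor_sum [RHS]big_mkcond/=.
under [RHS]eq_bigr do rewrite -(dvdn_pmul2l p0) mulnA -expnS.
rewrite -{}H [LHS]big_mkcond [RHS]big_mkcond/=; apply: eq_bigr => e _.
case: (boolP (p %| e)%N) => pe; last by rewrite andbF.
by rewrite andbT (mulnC p (e %/ p)%N) divnK.
Qed.

(** The full power of one prime is split off at a time, which suits functions determined by their
    values on prime powers. *)
Lemma pfactor_ind (P : nat -> Prop) : P 1%N ->
  (forall p k m, prime p -> ~~ (p %| m)%N -> (0 < m)%N -> P m ->
     P (p ^ k.+1 * m)%N) ->
  forall n, (0 < n)%N -> P n.
Proof.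
move=> P1 PM n; elim/ltn_ind: n => n IH n0.
case: (ltngtP n 1) => [|n1|->//]; first lia.
have pp := pdiv_prime n1; set p := pdiv n in pp.
have [m pm nE] := pfactor_coprime pp n0.
have : (0 < logn p n)%N by rewrite logn_gt0 mem_primes pp n0 pdiv_dvd.
case: (logn p n) nE => // k nE _.
have m0 : (0 < m)%N by move: n0; rewrite nE; case: (m).
rewrite nE mulnC; apply: PM => //; first by rewrite -prime_coprime.
apply: IH => //; rewrite nE -[X in (X < _)%N]muln1 ltn_pmul2l//.
by rewrite -(exp1n k.+1) ltn_exp2r// prime_gt1.
Qed.

(** * The Moebius and von Mangoldt functions *)

Section VonMangoldt.
Variable R : realType.

Definition mobius (n : nat) : R :=
  \prod_(q <- primes n) (if logn q n == 1%N then -1 else 0).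

(** [primes n] is a singleton exactly when n is a power p^k, k >= 1, of a prime p. *)
Definition von_mangoldt (n : nat) : R :=
  if primes n is [:: p] then ln p%:R else 0.

Lemma norm_mobius_le1 n : `|mobius n| <= 1.
Proof.
rewrite /mobius; elim/big_ind: _ => [|x y x1 y1|q _]; first by rewrite normr1.
  by rewrite normrM mulr_ile1.
by case: ifP; rewrite ?normrN ?normr1 ?normr0.
Qed.

Lemma mobius_prime_mul p m : prime p -> ~~ (p %| m)%N -> (0 < m)%N ->
  mobius (p * m) = - mobius m.
Proof.
move=> pp pm m0; have p0 := prime_gt0 pp.
have pE : perm_eq (primes (p * m)) (p :: primes m).
  apply: uniq_perm; first exact: primes_uniq.
    by rewrite /= primes_uniq mem_primes (negbTE pm) !andbF.
  by move=> q; rewrite primesM// primes_prime// !inE.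
have lpm : logn p (p * m) = 1%N.
  by rewrite lognM// logn_prime// eqxx lognE (negbTE pm) !andbF.
rewrite /mobius (perm_big _ pE) big_cons lpm eqxx /= mulN1r; congr (- _).
rewrite big_seq_cond [RHS]big_seq_cond; apply: eq_bigr => q /andP[qm _].
rewrite logn_Gauss//; move: qm; rewrite mem_primes => /and3P[qq _ qm].
rewrite prime_coprime// dvdn_prime2//.
by apply: contraNneq pm => <-.
Qed.

Lemma mobius_square_mul p m : prime p -> (0 < m)%N ->
  mobius (p * (p * m)) = 0.
Proof.
move=> pp m0; have p0 := prime_gt0 pp.
apply/eqP; rewrite /mobius prodf_seq_eq0; apply/hasP; exists p.
  by rewrite mem_primes pp !muln_gt0 p0 m0 dvdn_mulr.
by rewrite /= !lognM ?muln_gt0 ?p0// logn_prime// eqxx; case: (logn p m).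
Qed.

Lemma divisor_sum_mobius n : (0 < n)%N ->
  divisor_sum mobius n = (n == 1%N)%:R.
Proof.
move: n; apply: pfactor_ind => [|p k m pp pm m0 _].
  by rewrite /divisor_sum big_mkcond big_nat1 /mobius big_nil.
rewrite (_ : _ == _ = false); last first.
  by apply/negbTE; rewrite muln_eq1 expnS muln_eq1 (gtn_eqF (prime_gt1 pp)).
(* The divisors e and p e, for e dividing m, cancel in pairs; multiples of p^2 contribute 0. *)
have E : divisor_sum (fun e => mobius (p * e)) m = - divisor_sum mobius m.
  rewrite /divisor_sum -sumrN big_nat_cond [RHS]big_nat_cond.
  apply: eq_bigr => e /andP[/andP[e0 _] em]; apply: mobius_prime_mul => //.
  by apply: contra pm => /dvdn_trans; apply.
rewrite divisor_sum_pfactor//; case: k => [|k]; first by rewrite mul1n E subrr.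
rewrite divisor_sum_pfactor// E addrA subrr add0r /divisor_sum big_nat_cond.
by apply: big1 => e /andP[/andP[e0 _] _]; apply: mobius_square_mul.
Qed.

Lemma ln_nat_ge0 n : 0 <= ln n%:R :> R.
Proof.
by case: n => [|n]; [rewrite ln0// | apply: ln_ge0; rewrite ler1n].
Qed.

Lemma von_mangoldt_ge0 n : 0 <= von_mangoldt n.
Proof.
rewrite /von_mangoldt; case: (primes n) => [|p []]//.
exact: ln_nat_ge0.
Qed.

Lemma ln_natM m n : (0 < m)%N -> (0 < n)%N ->
  ln (m * n)%:R = ln m%:R + ln n%:R :> R.
Proof. by move=> m0 n0; rewrite natrM lnM// posrE ltr0n. Qed.

Lemma ln_natX m k : (0 < m)%N -> ln (m ^ k)%:R = k%:R * ln m%:R :> R.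
Proof. by move=> m0; rewrite natrX lnXn ?ltr0n// mulr_natl. Qed.

Lemma von_mangoldt_pfactor p j e : prime p -> ~~ (p %| e)%N -> (0 < e)%N ->
  von_mangoldt (p ^ j.+1 * e) = if e == 1%N then ln p%:R else 0.
Proof.
move=> pp pe e0; rewrite /von_mangoldt.
have p0 := prime_gt0 pp.
case: eqVneq => [->|e1]; first by rewrite muln1 primesX// primes_prime.
have q1 : (1 < e)%N by lia.
have pP : p \in primes (p ^ j.+1 * e).
  by rewrite mem_primes pp muln_gt0 expn_gt0 p0 e0 /= dvdn_mulr// dvdn_exp.
have qP : pdiv e \in primes (p ^ j.+1 * e).
  rewrite mem_primes (pdiv_prime q1) muln_gt0 expn_gt0 p0 e0 /= dvdn_mull//.
  exact: pdiv_dvd.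
case: (primes _) pP qP => [|q []]//; rewrite !inE => /eqP <- /eqP pq.
by move: pe; rewrite -pq pdiv_dvd.
Qed.

Lemma divisor_sum_von_mangoldt n : (0 < n)%N ->
  divisor_sum von_mangoldt n = ln n%:R.
Proof.
move: n; apply: pfactor_ind => [|p k m pp pm m0 IH].
  by rewrite /divisor_sum big_mkcond big_nat1 ln1.
have p0 := prime_gt0 pp.
have step j : divisor_sum (fun e => von_mangoldt (p ^ j.+1 * e)) m = ln p%:R.
  transitivity (divisor_sum (fun e => if e == 1%N then ln p%:R else 0 : R) m).
    apply: eq_divisor_sum => e e0 em; apply: von_mangoldt_pfactor => //.
    by apply: contra pm => /dvdn_trans; apply.
  rewrite /divisor_sum big_mkcond big_nat_recl//= dvd1n big_nat_cond.
  rewrite big1 ?addr0// => e /andP[/andP[e0 _] _].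
  by case: ifP => //; case: (e) e0.
have pows j : divisor_sum (fun e => von_mangoldt (p ^ j.+1 * e)) (p ^ k * m) =
    k.+1%:R * ln p%:R.
  elim: k j => [|k IHk] j; first by rewrite mul1n step mul1r.
  rewrite divisor_sum_pfactor// step.
  rewrite (_ : divisor_sum _ (p ^ k * m) = k.+1%:R * ln p%:R).
    by rewrite [in RHS]mulrSr mulrDl mul1r addrC.
  rewrite -(IHk j.+1); apply: eq_divisor_sum => e _ _.
  by rewrite mulnA -expnSr.
rewrite divisor_sum_pfactor// IH ln_natM ?expn_gt0 ?p0// addrC.
by rewrite (pows 0%N) ln_natX.
Qed.

Lemma von_mangoldt_le_ln n : (0 < n)%N -> von_mangoldt n <= ln n%:R.
Proof.
move=> n0; rewrite -divisor_sum_von_mangoldt// /divisor_sum.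
rewrite big_mkcond big_nat_recr//= dvdnn lerDr sumr_ge0// => e _.
by case: ifP => // _; apply: von_mangoldt_ge0.
Qed.

(** Each pair e, p e with e dividing m leaves - mobius e ln p, and the sum of mobius over the
    divisors of m vanishes unless m = 1. *)
Lemma divisor_sum_mobius_mul_ln n : (0 < n)%N ->
  divisor_sum (fun e => mobius e * ln e%:R) n = - von_mangoldt n.
Proof.
move: n; apply: pfactor_ind => [|p k m pp pm m0 _].
  by rewrite /divisor_sum big_mkcond big_nat1 ln1 mulr0 oppr0.
rewrite von_mangoldt_pfactor// divisor_sum_pfactor//.
have p0 := prime_gt0 pp.
have E : divisor_sum (fun e => mobius (p * e) * ln (p * e)%:R) m =
    - (m == 1%N)%:R * ln p%:R - divisor_sum (fun e => mobius e * ln e%:R) m.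
  rewrite -divisor_sum_mobius// /divisor_sum -sumrN -sumrN mulr_suml -big_split/=.
  rewrite big_nat_cond [RHS]big_nat_cond; apply: eq_bigr.
  move=> e /andP[/andP[e0 _] em]; rewrite mobius_prime_mul//; last first.
    by apply: contra pm => /dvdn_trans; apply.
  by rewrite ln_natM// mulrDr !mulNr.
have -> : divisor_sum (fun e => mobius (p * e) * ln (p * e)%:R) (p ^ k * m) =
          divisor_sum (fun e => mobius (p * e) * ln (p * e)%:R) m.
  case: k => [|k]; first by rewrite mul1n.
  rewrite divisor_sum_pfactor// -[RHS]addr0; congr (_ + _).
  rewrite /divisor_sum big_nat_cond big1// => e /andP[/andP[e0 _] _].
  by rewrite mobius_square_mul// mul0r.
by rewrite E; case: (m == 1%N) => /=; ring.
Qed.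

(** The parameter y shows up at n = 1 only. For y = N the weights ln (N / e), e <= N, are
    nonnegative of sum at most N, which keeps the error in [log_density_kernel] bounded. *)
Lemma divisor_sum_mobius_ln n (y : R) : (0 < n)%N -> 0 < y ->
  divisor_sum (fun e => mobius e * ln (y / e%:R)) n =
  von_mangoldt n + (n == 1%N)%:R * ln y.
Proof.
move=> n0 y0; rewrite -divisor_sum_mobius// -[von_mangoldt n]opprK.
rewrite -divisor_sum_mobius_mul_ln// /divisor_sum mulr_suml -sumrN -big_split.
rewrite [LHS]big_nat_cond [RHS]big_nat_cond; apply: eq_bigr.
move=> e /andP[/andP[e0 _] _] /=; rewrite ln_div ?posrE ?ltr0n//.
by rewrite mulrBr addrC.
Qed.

End VonMangoldt.

(** * Chebyshev's bound *)

Lemma cvgn_of_rate (R : realType) (u e : nat -> R) :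
    (forall M N, (M <= N)%N -> `|u N - u M| <= e M) ->
    e n @[n --> \oo] --> 0 ->
  cvgn u /\ forall M, `|limn u - u M| <= e M.
Proof.
move=> ue e0.
have cu : cvgn u.
  apply: cauchy_cvg; apply: cauchy_exP => eps eps0.
  have /cvgrPdist_lt /(_ _ eps0) [M _ HM] := e0.
  exists (u M), M => // N /= MN.
  rewrite -ball_normE /= distrC; apply: le_lt_trans (ue _ _ MN) _.
  by have := HM M (leqnn M); rewrite /= sub0r normrN => /ltr_normlW.
split=> // M; rewrite ler_distl; apply/andP; split.
  apply: limr_ge => //; exists M => // N /= MN.
  by have := ue M N MN; rewrite ler_distl => /andP[].
apply: limr_le => //; exists M => // N /= MN.
by have := ue M N MN; rewrite ler_distl => /andP[].
Qed.

Section Chebyshev.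
Variable R : realType.

Let Lambda : nat -> R := von_mangoldt R.

Definition chebyshev_psi (N : nat) : R := \sum_(1 <= m < N.+1) Lambda m.

Lemma ln_factorial N : ln (N`!%:R : R) = \sum_(1 <= n < N.+1) ln n%:R.
Proof.
elim: N => [|N IH]; first by rewrite big_geq// fact0 ln1.
by rewrite big_nat_recr//= factS mulnC ln_natM ?fact_gt0// IH.
Qed.

(** Legendre's formula: m divides [N %/ m] of the integers up to N. *)
Lemma ln_factorial_von_mangoldt N :
  ln (N`!%:R) = \sum_(1 <= m < N.+1) Lambda m * (N %/ m)%:R.
Proof.
rewrite ln_factorial.
transitivity (\sum_(1 <= n < N.+1) divisor_sum Lambda n).
  by apply: eq_big_nat => n /andP[n0 _]; rewrite divisor_sum_von_mangoldt.
rewrite (sum_divisor_sum (fun e _ => Lambda e)); apply: eq_bigr => m _.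
by rewrite sumr_const_nat subSS subn0 mulr_natr.
Qed.

Lemma ln_nat_le n : (0 < n)%N -> ln (n%:R : R) <= n%:R - 1.
Proof.
move=> n0; have := @le_ln1Dx R (n%:R - 1); rewrite addrCA subrr addr0; apply.
by rewrite ltrBrDl subrr ltr0n.
Qed.

(** The left side is the logarithm of the central binomial coefficient, one of the terms of (1 +
    1)^(2N). *)
Lemma ln_factorial_double N :
  ln ((N + N)`!%:R : R) - ln (N`!%:R) *+ 2 <= (N + N)%:R.
Proof.
have := bin_fact (leq_addr N N); rewrite addnK => <-.
have b0 : (0 < 'C(N + N, N))%N by rewrite bin_gt0 leq_addr.
rewrite ln_natM ?muln_gt0 ?fact_gt0// ln_natM ?fact_gt0// mulr2n.
rewrite addrK; have : ln 'C(N + N, N)%:R <= ln ((2 ^ (N + N))%:R : R).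
  rewrite ler_ln ?posrE ?ltr0n ?expn_gt0// ler_nat.
  have := Pascal 1 1 (N + N) => ->.
  have lt : (N < (N + N).+1)%N by lia.
  rewrite (bigD1 (Ordinal lt))//= !exp1n !muln1.
  exact: leq_addr.
move=> /le_trans; apply; rewrite ln_natX// ler_piMr//.
by have := @ln_nat_le 2 isT; lra.
Qed.

(** In ln (2N)! - 2 ln N! the coefficient of Lambda m is floor (2N / m) - 2 floor (N / m): never
    negative, and at least 1 for N < m <= 2N. *)
Lemma chebyshev_psi_double N :
  chebyshev_psi (N + N) - chebyshev_psi N <= (N + N)%:R.
Proof.
apply: le_trans (ln_factorial_double N); rewrite !ln_factorial_von_mangoldt.
rewrite /chebyshev_psi (@big_cat_nat _ _ _ N.+1)//=; last lia.
rewrite [X in X - _]addrC addrK.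
rewrite [X in _ <= X - _](@big_cat_nat _ _ _ N.+1)//=; last lia.
rewrite -sumrMnl [X in _ <= X - _]addrC -addrA -sumrB -[X in X <= _]addr0.
rewrite lerD//.
  apply: ler_sum_nat => m /andP[Nm mN]; rewrite ler_peMr ?von_mangoldt_ge0//.
  by rewrite ler1n divn_gt0; lia.
rewrite big_nat_cond sumr_ge0// => m /andP[/andP[m0 _] _].
rewrite -mulrnAr -mulrBr mulr_ge0 ?von_mangoldt_ge0// subr_ge0 -mulrnA.
by rewrite ler_nat muln2 -addnn leq_divRL// mulnDl leq_add ?leq_divM.
Qed.

(** By halving: psi (2M) <= psi M + 2M <= 6M, and for odd N the last term adds at most ln (2M + 1)
    <= 2M. *)
Lemma chebyshev_psi_le N : chebyshev_psi N <= 4 * N%:R.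
Proof.
elim/ltn_ind: N => N IH.
case: (posnP N) => [->|N0]; first by rewrite /chebyshev_psi big_geq// mulr0.
set M := N./2; have MN : (M < N)%N by rewrite /M; lia.
have HM := IH _ MN; have H2 := chebyshev_psi_double M.
rewrite natrD in H2.
have : N = (odd N + (M + M))%N by rewrite addnn odd_double_half.
clearbody M; case: (odd N) => NE; last first.
  have : 0 <= M%:R :> R by [].
  by rewrite NE add0n natrD; lra.
rewrite NE add1n {1}/chebyshev_psi big_nat_recr//=.
rewrite -/(chebyshev_psi _).
have := @von_mangoldt_le_ln R (M + M).+1 isT.
have := @ln_nat_le (M + M).+1 isT.
rewrite -(@natr1 _ (M + M)) natrD /Lambda.
have : 0 <= M%:R :> R by [].
lra.
Qed.

(** The sum is the logarithm of N^N / N!, a single term of the series of e^N. *)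
Lemma sum_ln_div_le N :
  \sum_(1 <= n < N.+1) ln (N%:R / n%:R : R) <= N%:R.
Proof.
case: (posnP N) => [->|N0]; first by rewrite big_geq.
have -> : \sum_(1 <= n < N.+1) ln (N%:R / n%:R : R) =
    ln ((N%:R ^+ N) / N`!%:R).
  rewrite ln_div ?posrE ?exprn_gt0 ?ltr0n ?fact_gt0// ln_factorial.
  have -> : ln (N%:R ^+ N) = \sum_(1 <= n < N.+1) ln (N%:R : R).
    by rewrite sumr_const_nat subSS subn0 lnXn ?ltr0n.
  rewrite -sumrB.
  apply: eq_big_nat => n /andP[n0 _].
  by rewrite ln_div ?posrE ?ltr0n.
rewrite -[leRHS]expRK ler_ln ?posrE ?expR_gt0 ?divr_gt0 ?exprn_gt0 ?ltr0n ?fact_gt0//.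
case: N N0 => // N _.
have := @expR_ge1Dxn R (N.+1%:R) N (ler0n _ _); lra.
Qed.

End Chebyshev.

(** * Partial sums of periodic functions *)

Section AbelSummation.
Variable R : realType.
Implicit Types (g u : nat -> R).

Let Lambda : nat -> R := von_mangoldt R.

(** Summation by parts: the boundary terms cost C u_N + C u_M, and the telescoping part C (u_M -
    u_N). *)
Lemma abel_sum_bound g u C M N :
    (forall n, `|\sum_(0 <= k < n) g k| <= C) ->
    (forall n, (M <= n)%N -> 0 <= u n) ->
    (forall n, (M <= n)%N -> u n.+1 <= u n) -> (M <= N)%N ->
  `|\sum_(M <= n < N) g n * u n| <= 2 * C * u M.
Proof.
move=> gC u0 uD MN; pose G n := \sum_(0 <= k < n) g k.
have -> : \sum_(M <= n < N) g n * u n =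
    G N * u N - G M * u M + \sum_(M <= n < N) G n.+1 * (u n - u n.+1).
  rewrite -(telescope_sumr (fun n => G n * u n) MN) -big_split/=; apply: eq_bigr => n _.
  by rewrite /G big_nat_recr//=; ring.
have : `|\sum_(M <= n < N) G n.+1 * (u n - u n.+1)| <= C * (u M - u N).
  rewrite -opprB -(telescope_sumr u MN) -sumrN mulr_sumr.
  apply: le_trans (ler_norm_sum _ _ _) _; apply: ler_sum_nat => n /andP[Mn _].
  have h : 0 <= u n - u n.+1 by rewrite subr_ge0 uD.
  by rewrite normrM opprB (ger0_norm h) ler_wpM2r//; exact: gC.
have GN : `|G N * u N| <= C * u N.
  by rewrite normrM (ger0_norm (u0 _ _))// ler_wpM2r ?u0//; exact: gC.
have GM : `|G M * u M| <= C * u M.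
  by rewrite normrM (ger0_norm (u0 _ _))// ler_wpM2r ?u0//; exact: gC.
move=> GS; apply: le_trans (ler_normD _ _) _.
apply: le_trans (lerD (ler_normB _ _) (lexx _)) _; lra.
Qed.

Definition dirichlet_value g : R :=
  limn (fun N => \sum_(1 <= k < N.+1) g k / k%:R).

Lemma dirichlet_value_rate g C : 0 <= C ->
    (forall n, `|\sum_(0 <= k < n) g k| <= C) ->
  cvgn (fun N => \sum_(1 <= k < N.+1) g k / k%:R) /\
  forall N, `|dirichlet_value g - \sum_(1 <= k < N.+1) g k / k%:R|
            <= 2 * C / N.+1%:R.
Proof.
move=> C0 gC; apply: cvgn_of_rate => [M N MN|].
  rewrite (@big_cat_nat _ _ _ M.+1 1 N.+1)//= [X in X - _]addrC addrK.
  apply: (@abel_sum_bound g (fun n => n%:R^-1)) => // n Mn.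
  rewrite lef_pV2 ?posrE ?ltr0n ?ler_nat//; lia.
rewrite -[X in _ --> X](mulr0 (2 * C)).
by apply: cvgM; [exact: cvg_cst | exact: cvg_harmonic].
Qed.

Definition bounded_seq (u : nat -> R) : Prop :=
  exists C, forall N, (0 < N)%N -> `|u N| <= C.

(** A density relative to the weights [Lambda n / n], whose sum up to N is ln N + O(1). A bounded
    error, rather than a limit of quotients, is what the summation arguments produce directly. *)
Definition log_density (w : nat -> R) (delta : R) : Prop := bounded_seq (fun N =>
  \sum_(1 <= n < N.+1) Lambda n / n%:R * w n - delta * ln N%:R).

Lemma inv_divnS_le (N e : nat) : (0 < N)%N -> (0 < e)%N ->
  (N %/ e).+1%:R^-1 <= e%:R / N%:R :> R.
Proof.
move=> N0 e0; rewrite ler_pdivlMr ?ltr0n// mulrC ler_pdivrMr ?ltr0n//.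
by rewrite -natrM ler_nat mulnC ltnW// ltn_ceil.
Qed.

(** ln n / n still increases up to e; adding 2 to the logarithm yields a sequence that decreases
    from n = 1 on, with steps large enough to majorize ln n / n^2. *)
Lemma ln_div_square_le m : (0 < m)%N ->
  ln m.+1%:R / m.+1%:R ^+ 2 <=
  (ln m%:R + 2) / m%:R - (ln m.+1%:R + 2) / m.+1%:R :> R.
Proof.
move=> m0; have x1 : 1 <= m%:R :> R by rewrite ler1n.
have x0 : 0 < m%:R :> R by rewrite ltr0n.
have h : ln m.+1%:R <= ln m%:R + m%:R^-1 :> R.
  have -> : m.+1%:R = m%:R * (1 + m%:R^-1) :> R.
    by rewrite mulrDr mulr1 divff ?gt_eqF// natr1.
  rewrite lnM ?posrE ?addr_gt0 ?invr_gt0// lerD2l le_ln1Dx//.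
  by rewrite (lt_trans (_ : _ < 0)) ?invr_gt0// ltrN10.
have l0 := ln_nat_ge0 R m.+1; rewrite -(natr1 m) in h l0 *.
move: x1 x0 h l0; move: (ln (m%:R + 1)) (ln m%:R) => l k.
move: (m%:R : R) => x x1 x0 h l0.
have x10 : 0 < x + 1 by lra.
apply: (@le_trans _ _ ((l - x^-1 + 2) / x - (l + 2) / (x + 1))); last first.
  by rewrite lerD2r ler_wpM2r ?invr_ge0 ?(ltW x0)//; lra.
rewrite -subr_ge0.
have -> : (l - x^-1 + 2) / x - (l + 2) / (x + 1) - l / (x + 1) ^+ 2 =
   (l * x + (x - 1) * (x + 1)) / (x ^+ 2 * (x + 1) ^+ 2).
  by field; rewrite !gt_eqF.
rewrite divr_ge0 ?mulr_ge0 ?exprn_ge0 ?(ltW x0) ?(ltW x10)//.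
by rewrite addr_ge0 ?mulr_ge0 ?subr_ge0 ?(ltW x0) ?(ltW x10).
Qed.

Lemma ln_plus2_div_decr n : (0 < n)%N ->
  (ln n.+1%:R + 2) / n.+1%:R <= (ln n%:R + 2) / n%:R :> R.
Proof.
move=> n0; rewrite -subr_ge0; apply: le_trans (ln_div_square_le n0).
by rewrite divr_ge0 ?ln_nat_ge0// exprn_ge0.
Qed.

Lemma sum_ln_div_bound g C : 0 <= C ->
    (forall n, `|\sum_(0 <= k < n) g k| <= C) -> forall N,
  `|\sum_(1 <= n < N.+1) g n * (ln n%:R / n%:R)| <= 8 * C.
Proof.
move=> C0 gC N.
(* The monotone weights (ln n + 2) / n and 1 / n start at 2 and 1, so the two parts cost 4C each. *)
have -> : \sum_(1 <= n < N.+1) g n * (ln n%:R / n%:R) =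
    \sum_(1 <= n < N.+1) g n * ((ln n%:R + 2) / n%:R)
    - 2 * \sum_(1 <= n < N.+1) g n * n%:R^-1.
  by rewrite mulr_sumr -sumrB; apply: eq_bigr => n _; ring.
have H1 : `|\sum_(1 <= n < N.+1) g n * ((ln n%:R + 2) / n%:R)| <=
    2 * C * ((ln 1%:R + 2) / 1%:R).
  apply: (@abel_sum_bound g (fun n => (ln n%:R + 2) / n%:R)) => // n n1.
    by rewrite divr_ge0// addr_ge0// ln_nat_ge0.
  exact: ln_plus2_div_decr.
have H2 : `|\sum_(1 <= n < N.+1) g n * n%:R^-1| <= 2 * C * 1%:R^-1.
  apply: (@abel_sum_bound g (fun n => n%:R^-1)) => // n n1.
  by rewrite lef_pV2 ?posrE ?ltr0n ?ler_nat.
move: H1 H2; rewrite ln1 add0r invr1 !mulr1 => H1 H2.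
apply: le_trans (ler_normB _ _) _; rewrite normrM ger0_norm//; lra.
Qed.

End AbelSummation.

(** * Mertens-type estimates for periodic functions *)

Section PeriodicSums.
Variables (R : realType) (d : nat).
Hypothesis d0 : (0 < d)%N.
Implicit Types (g u : nat -> R).

Let Lambda : nat -> R := von_mangoldt R.

Lemma periodic_partial_sum g : (forall n, g (n %% d)%N = g n) ->
    \sum_(0 <= k < d) g k = 0 ->
  forall n, `|\sum_(0 <= k < n) g k| <= \sum_(0 <= k < d) `|g k|.
Proof.
move=> gd g0; elim/ltn_ind => n IH; case: (ltnP n d) => nd.
  rewrite [leRHS](@big_cat_nat _ _ _ n)//= ?(ltnW nd)//.
  apply: le_trans (ler_norm_sum _ _ _) _.
  by rewrite lerDl sumr_ge0.
rewrite (@big_cat_nat _ _ _ d)//= g0 add0r -{1}[d]add0n big_addn.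
rewrite (eq_bigr g) => [|i _]; last by rewrite -gd modnDr gd.
by apply: IH; lia.
Qed.

(** The mean is required to vanish along every dilate, also for m sharing a factor with d, because
    the operator L evaluates g along all of them. *)
Definition zero_mean g : Prop := (forall n, g (n %% d)%N = g n) /\
  forall m, \sum_(0 <= k < d) g (m * k)%N = 0.

(** One constant serves all dilates m; the density estimates sum over m up to N and depend on this
    uniformity. *)
Lemma zero_mean_bound g : zero_mean g -> exists2 C : R, 0 <= C &
  forall m n, `|\sum_(0 <= k < n) g (m * k)%N| <= C.
Proof.
move=> [gd g0]; pose B := \sum_(0 <= k < d) `|g k|.
have gB n : `|g n| <= B.
  rewrite -gd /B (@big_cat_nat _ _ _ (n %% d))//= ?(ltnW (ltn_pmod _ _))//.
  rewrite [X in _ <= _ + X]big_ltn ?ltn_pmod// addrCA lerDl.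
  by rewrite addr_ge0// sumr_ge0.
exists (\sum_(0 <= k < d) B) => [|m n]; first by rewrite sumr_ge0// => _ _; exact: sumr_ge0.
apply: le_trans (periodic_partial_sum _ _ _) _ => //.
- by move=> k; rewrite -[LHS]gd modnMmr gd.
- by apply: ler_sum => k _.
Qed.

Lemma zero_mean_dilate g m : zero_mean g -> zero_mean (fun n => g (m * n)%N).
Proof.
move=> [gd g0]; split=> [n|k]; first by rewrite -[LHS]gd modnMmr gd.
by rewrite -[RHS](g0 (m * k)%N); apply: eq_bigr => i _; rewrite mulnA.
Qed.

(** Expand the bounded sum of g n ln n / n by ln n = \sum_(e | n) Lambda e. Completing the inner sum
    over k <= N / e to its limit costs at most 2 C Lambda e / N, in total 8C by Chebyshev's
    bound. *)
Lemma log_density_dirichlet_value g : zero_mean g ->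
  log_density (fun m => dirichlet_value (fun n => g (m * n)%N)) 0.
Proof.
move=> zg; have [C C0 gC] := zero_mean_bound zg; exists (16 * C) => N N0.
have g1 n : `|\sum_(0 <= k < n) g k| <= C.
  by have := gC 1%N n; under eq_bigr do rewrite mul1n.
have := sum_ln_div_bound C0 g1 N.
have -> : \sum_(1 <= n < N.+1) g n * (ln n%:R / n%:R) =
  \sum_(1 <= e < N.+1) \sum_(1 <= k < (N %/ e).+1)
    Lambda e / e%:R * (g (e * k)%N / k%:R).
  rewrite -(sum_divisor_sum (fun e k => Lambda e / e%:R * (g (e * k)%N / k%:R))).
  apply: eq_big_nat => n /andP[n0 _].
  rewrite -divisor_sum_von_mangoldt// mulrCA /divisor_sum mulr_suml.
  rewrite big_nat_cond [RHS]big_nat_cond; apply: eq_bigr.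
  move=> e /andP[/andP[e0 _] en]; rewrite -{1 2}(divnK en).
  have k0 : (n %/ e)%:R != 0 :> R by rewrite pnatr_eq0 -lt0n divn_gt0// dvdn_leq.
  have e0' : e%:R != 0 :> R by rewrite pnatr_eq0 -lt0n.
  by rewrite mulnC natrM -/Lambda; field; apply/andP.
set T := \sum_(1 <= e < N.+1) _ => HT; rewrite mul0r subr0.
rewrite -[X in `|X|](subrK T) (le_trans (ler_normD _ _))//.
suff : `|\sum_(1 <= n < N.+1) Lambda n / n%:R *
    dirichlet_value (fun k => g (n * k)%N) - T| <= 8 * C by lra.
rewrite /T -sumrB; apply: le_trans (ler_norm_sum _ _ _) _.
apply: (@le_trans _ _ (\sum_(1 <= n < N.+1) 2 * C / N%:R * Lambda n)).
  apply: ler_sum_nat => e /andP[e0 _].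
  rewrite -mulr_sumr -mulrBr normrM ger0_norm; last first.
    by rewrite divr_ge0// von_mangoldt_ge0.
  have [_ /(_ (N %/ e)%N)] := dirichlet_value_rate C0 (gC e).
  move=> /(ler_wpM2l (divr_ge0 (von_mangoldt_ge0 R e) (ler0n R e))).
  move=> /le_trans; apply.
  have : 2 * C / (N %/ e).+1%:R <= 2 * C * (e%:R / N%:R).
    by rewrite ler_wpM2l ?mulr_ge0// inv_divnS_le.
  move=> /(ler_wpM2l (divr_ge0 (von_mangoldt_ge0 R e) (ler0n R e))).
  move=> /le_trans; apply; rewrite le_eqVlt; apply/orP; left; apply/eqP.
  have e0' : e%:R != 0 :> R by rewrite pnatr_eq0 -lt0n.
  have N0' : N%:R != 0 :> R by rewrite pnatr_eq0 -lt0n.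
  by rewrite -/(Lambda e); field; apply/andP.
rewrite -mulr_sumr -/(chebyshev_psi R N) mulrAC ler_pdivrMr ?ltr0n//.
have := ler_wpM2l C0 (chebyshev_psi_le R N); lra.
Qed.

(** By [divisor_sum_mobius_ln] at y = N the inner sums are partial sums of series of value 0, hence
    at most 2 C e / N; their weights are at most ln (N / e) / e, so the total is at most 2C. *)
Lemma log_density_kernel g : zero_mean g ->
    (forall m, (0 < m)%N -> dirichlet_value (fun n => g (m * n)%N) = 0) ->
  log_density g (- g 1%N).
Proof.
move=> zg g0; have [C C0 gC] := zero_mean_bound zg; exists (2 * C) => N N0.
have N0' : 0 < N%:R :> R by rewrite ltr0n.
have -> : \sum_(1 <= n < N.+1) Lambda n / n%:R * g n - - g 1%N * ln N%:R =
   \sum_(1 <= e < N.+1) \sum_(1 <= k < (N %/ e).+1)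
    mobius R e * ln (N%:R / e%:R) / e%:R * (g (e * k)%N / k%:R).
  rewrite -(sum_divisor_sum (fun e k =>
    mobius R e * ln (N%:R / e%:R) / e%:R * (g (e * k)%N / k%:R))).
  have -> : - g 1%N * ln N%:R =
    - \sum_(1 <= n < N.+1) g n / n%:R * ((n == 1%N)%:R * ln N%:R).
    rewrite big_ltn// big_nat_cond big1 => [|n /andP[/andP[n1 _] _]].
      by rewrite eqxx mul1r divr1 addr0 mulNr.
    by rewrite gtn_eqF// mul0r mulr0.
  rewrite opprK -big_split/=; apply: eq_big_nat => n /andP[n0 _].
  transitivity (g n / n%:R * (Lambda n + (n == 1%N)%:R * ln N%:R)); first by ring.
  rewrite -divisor_sum_mobius_ln// /divisor_sum mulr_sumr.
  rewrite big_nat_cond [RHS]big_nat_cond; apply: eq_bigr.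
  move=> e /andP[/andP[e0 _] en]; rewrite -{1 2}(divnK en).
  have k0 : (n %/ e)%:R != 0 :> R by rewrite pnatr_eq0 -lt0n divn_gt0// dvdn_leq.
  have e0' : e%:R != 0 :> R by rewrite pnatr_eq0 -lt0n.
  by rewrite mulnC natrM; field; apply/andP.
apply: le_trans (ler_norm_sum _ _ _) _.
apply: (@le_trans _ _ (\sum_(1 <= n < N.+1) 2 * C / N%:R * ln (N%:R / n%:R))).
  apply: ler_sum_nat => e /andP[e0 eN].
  have e0' : 0 < e%:R :> R by rewrite ltr0n.
  have l0 : 0 <= ln (N%:R / e%:R) :> R.
    by rewrite ln_ge0// ler_pdivlMr// mul1r ler_nat.
  rewrite -mulr_sumr normrM.
  have [_ /(_ (N %/ e)%N)] := dirichlet_value_rate C0 (gC e).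
  rewrite g0// sub0r normrN => H.
  have {}H : `|\sum_(1 <= k < (N %/ e).+1) g (e * k)%N / k%:R| <=
      2 * C * (e%:R / N%:R).
    by apply: le_trans H _; rewrite ler_wpM2l ?mulr_ge0// inv_divnS_le.
  have Hm : `|mobius R e * ln (N%:R / e%:R) / e%:R| <= ln (N%:R / e%:R) / e%:R.
    rewrite !normrM normfV (ger0_norm l0) (gtr0_norm e0').
    rewrite ler_wpM2r ?invr_ge0 ?(ltW e0')// -[leRHS]mul1r ler_wpM2r//.
    exact: norm_mobius_le1.
  apply: le_trans (ler_pM _ _ Hm H) _ => //; rewrite le_eqVlt; apply/orP; left; apply/eqP.
  by field; rewrite !gt_eqF.
rewrite -mulr_sumr mulrAC ler_pdivrMr// ler_wpM2l ?mulr_ge0//.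
exact: sum_ln_div_le.
Qed.

Definition coprime_ind (n : nat) : R := (coprime d n)%:R.

(** Mertens' argument: the sum of ln n over the n <= N prime to d is kappa N W + O(N) by expanding
    ln n into Lambda, and kappa N ln N + O(N) by counting. *)
Lemma log_density_coprime : log_density coprime_ind 1.
Proof.
pose kappa : R := (\sum_(0 <= k < d) coprime_ind k) / d%:R.
have d0' : 0 < d%:R :> R by rewrite ltr0n.
have cM m n : coprime_ind (m * n) = coprime_ind m * coprime_ind n.
  by rewrite /coprime_ind coprimeMr -natrM mulnb.
have c0 n : 0 <= coprime_ind n by [].
have c1 n : coprime_ind n <= 1 by rewrite /coprime_ind; case: coprime.
have kappa0 : 0 < kappa.
  rewrite divr_gt0// (@big_cat_nat _ _ _ (1 %% d))//= ?(ltnW (ltn_pmod _ _))//.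
  rewrite [X in _ + X]big_ltn ?ltn_pmod//.
  rewrite addrCA ltr_pwDl ?addr_ge0 ?sumr_ge0//.
  by rewrite /coprime_ind coprime_modr coprimen1.
pose B := \sum_(0 <= k < d) `|coprime_ind k - kappa|.
have HB : forall n, `|\sum_(0 <= k < n) (coprime_ind k - kappa)| <= B.
  apply: periodic_partial_sum.
    by move=> n; rewrite /coprime_ind coprime_modr.
  rewrite sumrB sumr_const_nat subn0 /kappa -[X in _ - X]mulr_natr divfK ?subrr//.
  by rewrite gt_eqF.
have B0 : 0 <= B by rewrite sumr_ge0.
pose cnt n := \sum_(1 <= k < n.+1) coprime_ind k.
have Hcnt n : `|cnt n - kappa * n%:R| <= B + 1 + kappa.
  have := HB n.+1; rewrite sumrB sumr_const_nat subn0 big_ltn//.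
  rewrite -/(cnt n) -[kappa *+ _]mulr_natr -(natr1 n); have := c0 0%N; have := c1 0%N.
  rewrite !ler_norml; lra.
pose C1 := B + 1 + kappa.
have C10 : 0 <= C1 by rewrite /C1; lra.
(* The errors are 4 (C1 + kappa) N from A2, N from A4 and C1 N from A5, divided by kappa N. *)
exists ((5 * C1 + 4 * kappa + 1) / kappa) => N N0.
have N0' : 0 < N%:R :> R by rewrite ltr0n.
set W := \sum_(1 <= n < N.+1) _.
rewrite mul1r ler_pdivlMr// -(ler_pM2r N0').
have A1 : \sum_(1 <= n < N.+1) coprime_ind n * ln n%:R =
    \sum_(1 <= e < N.+1) Lambda e * coprime_ind e * cnt (N %/ e)%N.
  under [RHS]eq_bigr do rewrite mulr_sumr.
  rewrite -(sum_divisor_sum (fun e k => Lambda e * coprime_ind e * coprime_ind k)).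
  apply: eq_big_nat => n /andP[n0 _].
  rewrite -divisor_sum_von_mangoldt// /divisor_sum mulr_sumr.
  rewrite big_nat_cond [RHS]big_nat_cond; apply: eq_bigr.
  move=> e /andP[/andP[e0 _] en]; rewrite -{1}(divnK en) cM -/Lambda; ring.
have A2 : `|\sum_(1 <= n < N.+1) coprime_ind n * ln n%:R - kappa * N%:R * W|
    <= (C1 + kappa) * (4 * N%:R).
  rewrite A1 /W mulr_sumr -sumrB; apply: le_trans (ler_norm_sum _ _ _) _.
  apply: (@le_trans _ _ (\sum_(1 <= n < N.+1) (C1 + kappa) * Lambda n)); last first.
    by rewrite -mulr_sumr ler_wpM2l ?addr_ge0 ?(ltW kappa0)// chebyshev_psi_le.
  apply: ler_sum_nat => e /andP[e0 eN].
  have e0' : 0 < e%:R :> R by rewrite ltr0n.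
  have -> : Lambda e * coprime_ind e * cnt (N %/ e)%N -
     kappa * N%:R * (Lambda e / e%:R * coprime_ind e) =
     coprime_ind e * (cnt (N %/ e)%N - kappa * (N%:R / e%:R)) * Lambda e.
    by ring.
  rewrite normrM (ger0_norm (von_mangoldt_ge0 _ _)).
  rewrite ler_wpM2r ?von_mangoldt_ge0// normrM (ger0_norm (c0 _)).
  rewrite -[leRHS]mul1r ler_pM//.
  have q1 : (N %/ e)%:R <= N%:R / e%:R :> R.
    by rewrite ler_pdivlMr// -natrM ler_nat leq_divM.
  have q2 : N%:R / e%:R <= (N %/ e)%:R + 1 :> R.
    by rewrite natr1 ler_pdivrMr// -natrM ler_nat ltnW// ltn_ceil.
  have := Hcnt (N %/ e)%N; rewrite !ler_norml -/C1.
  have := ler_wpM2l (ltW kappa0) q1; have := ler_wpM2l (ltW kappa0) q2.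
  by rewrite mulrDr mulr1; lra.
have A3 : \sum_(1 <= n < N.+1) coprime_ind n * ln n%:R =
    cnt N * ln N%:R - \sum_(1 <= n < N.+1) coprime_ind n * ln (N%:R / n%:R).
  rewrite /cnt mulr_suml -sumrB; apply: eq_big_nat => n /andP[n0 _].
  by rewrite ln_div ?posrE ?ltr0n//; ring.
have A4 : 0 <= \sum_(1 <= n < N.+1) coprime_ind n * ln (N%:R / n%:R) <= N%:R.
  have l0 n : (0 < n < N.+1)%N -> 0 <= ln (N%:R / n%:R) :> R.
    by move=> /andP[n0 nN]; rewrite ln_ge0// ler_pdivlMr ?ltr0n// mul1r ler_nat.
  rewrite big_nat_cond sumr_ge0 => [|n /andP[n0 _]]; last by rewrite mulr_ge0// l0.
  rewrite -big_nat_cond; apply: le_trans (sum_ln_div_le R N).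
  by apply: ler_sum_nat => n n0; rewrite ler_piMl// l0.
have A5 : `|cnt N * ln N%:R - kappa * N%:R * ln N%:R| <= C1 * N%:R.
  rewrite -mulrBl normrM ler_pM// ger0_norm ?ln_nat_ge0//.
  by apply: le_trans (ln_nat_le R N0) _; lra.
have -> : `|W - ln N%:R| * kappa * N%:R =
    `|kappa * N%:R * W - kappa * N%:R * ln N%:R|.
  have h : 0 <= kappa * N%:R by rewrite mulr_ge0// ltW.
  by rewrite -mulrBr normrM (ger0_norm h); ring.
move: A2 A5; rewrite A3 !ler_norml; move: A4.
move: (\sum_(1 <= n < N.+1) coprime_ind n * ln (N%:R / n%:R)) => Z.
move: (cnt N * ln N%:R) (kappa * N%:R * ln N%:R) (kappa * N%:R * W) => X Y V.
rewrite !mulrDl !mulrDr; have : 0 <= kappa * N%:R by rewrite mulr_ge0// ltW.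
lra.
Qed.

End PeriodicSums.

(** * The exceptional character *)

Section LogDensity.
Variable R : realType.
Implicit Types (u v : nat -> R).

Lemma eq_log_density u v a : (forall n, (0 < n)%N -> u n = v n) ->
  log_density u a -> log_density v a.
Proof.
move=> uv [C H]; exists C => N N0; have := H N N0.
congr (`|_ - _| <= _); apply: eq_big_nat => n /andP[n0 _].
by rewrite uv.
Qed.

Lemma log_densityD u v a b : log_density u a -> log_density v b ->
  log_density (fun n => u n + v n) (a + b).
Proof.
move=> [C HC] [D HD]; exists (C + D) => N N0.
apply: le_trans (lerD (HC N N0) (HD N N0)).
apply: le_trans (ler_normD _ _); rewrite le_eqVlt; apply/orP; left; apply/eqP.
congr `|_|; rewrite [in LHS](eq_bigr (fun n =>
  von_mangoldt R n / n%:R * u n + von_mangoldt R n / n%:R * v n)).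
  by rewrite big_split/=; ring.
by move=> n _; rewrite mulrDr.
Qed.

Lemma log_densityZ u a c : log_density u a ->
  log_density (fun n => c * u n) (c * a).
Proof.
move=> [C HC]; exists (`|c| * C) => N N0.
apply: le_trans (ler_wpM2l (normr_ge0 c) (HC N N0)).
rewrite -normrM le_eqVlt; apply/orP; left; apply/eqP; congr `|_|.
rewrite mulrBr mulrA mulr_sumr; congr (_ - _); apply: eq_bigr => n _; ring.
Qed.

Lemma log_density0 : log_density (fun=> 0 : R) 0.
Proof. by exists 0 => N _; rewrite big1 => [|n _]; rewrite ?mul0r ?mulr0// subrr normr0. Qed.

Lemma log_density_sum (I : Type) (r : seq I) (f : I -> nat -> R) (a : I -> R) :
  (forall i, log_density (f i) (a i)) ->
  log_density (fun n => \sum_(i <- r) f i n) (\sum_(i <- r) a i).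
Proof.
move=> fa; elim: r => [|i r IH].
  rewrite big_nil; apply: eq_log_density log_density0 => n _.
  by rewrite big_nil.
rewrite big_cons; apply: eq_log_density (log_densityD (fa i) IH) => n _.
by rewrite big_cons.
Qed.

Lemma ln_nat_unbounded (C : R) : exists2 N, (0 < N)%N & C < ln N%:R.
Proof.
exists (Num.truncn (expR C)).+1 => //.
rewrite -ltr_expR lnK ?posrE ?ltr0n//; exact: truncnS_gt.
Qed.

Lemma log_density_ge0 u a : (forall n, 0 <= u n) -> log_density u a -> 0 <= a.
Proof.
move=> u0 [C HC]; rewrite leNgt; apply/negP => a0.
have [N N0 HN] := ln_nat_unbounded (C / - a).
have := HC N N0; rewrite ler_norml => /andP[_].
have : 0 <= \sum_(1 <= n < N.+1) von_mangoldt R n / n%:R * u n.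
  by apply: sumr_ge0 => n _; rewrite mulr_ge0// divr_ge0// von_mangoldt_ge0.
by move: HN; rewrite ltr_pdivrMr ?oppr_gt0//; lra.
Qed.

Lemma log_density_unique u a b : log_density u a -> log_density u b -> a = b.
Proof.
move=> ua ub; apply/le_anti/andP; split; rewrite -subr_ge0.
  have := log_density_ge0 _ (log_densityD ub (log_densityZ (-1) ua)).
  by rewrite mulN1r; apply=> n; rewrite mulN1r subrr.
have := log_density_ge0 _ (log_densityD ua (log_densityZ (-1) ub)).
by rewrite mulN1r; apply=> n; rewrite mulN1r subrr.
Qed.

End LogDensity.

(** Factor P through its rank; idempotence makes the factors compose to the identity in the opposite
    order, and the trace is cyclic. *)
Lemma mxtrace_idempotent (F : fieldType) n (P : 'M[F]_n) :
  P *m P = P -> \tr P = (\rank P)%:R.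
Proof.
move=> PP; have BC : row_base P *m col_base P = 1%:M.
  apply: (row_full_inj (col_base_full P)); rewrite mulmx1.
  apply: (row_free_inj (row_base_free P)) => /=.
  transitivity (P *m P); last by rewrite PP mulmx_base.
  by rewrite -[in RHS](mulmx_base P) !mulmxA.
by rewrite -[in LHS](mulmx_base P) mxtrace_mulC BC mxtrace1.
Qed.

(** * The operator L as a matrix on residues modulo d *)

Section Residues.
Variables (R : realType) (D : nat).
Let d := D.+1.
Let d0 : (0 < d)%N := isT.
Let c : nat -> R := coprime_ind R d.

Let c_mod n : c (n %% d)%N = c n.
Proof. by rewrite /c /coprime_ind coprime_modr. Qed.

Let cM m n : c (m * n)%N = c m * c n.
Proof. by rewrite /c /coprime_ind coprimeMr -natrM mulnb. Qed.

Let cE n : coprime d n -> c n = 1.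
Proof. by rewrite /c /coprime_ind => ->. Qed.

Let cN n : ~~ coprime d n -> c n = 0.
Proof. by rewrite /c /coprime_ind => /negbTE ->. Qed.

Let cc n : c n * c n = c n.
Proof. by rewrite /c /coprime_ind -natrM mulnb andbb. Qed.

Let inord_modn (r : 'I_d) : inord (r %% d) = r.
Proof. by rewrite modn_small// inord_val. Qed.

Lemma sum_dilate_coprime (f : nat -> R) m :
    (forall n, f (n %% d)%N = f n) -> coprime d m ->
  \sum_(0 <= k < d) f (m * k)%N = \sum_(0 <= k < d) f k.
Proof.
move=> fd dm; rewrite !big_mkord.
pose h (k : 'I_d) : 'I_d := inord (m * k %% d).
have hE k : h k = (m * k %% d)%N :> nat by rewrite inordK// ltn_pmod.
have hinj : injective h.
  move=> i j /(congr1 val) /=; rewrite !hE => ij; apply/val_inj => /=.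
  wlog lij : i j ij / (i <= j)%N.
    by move=> W; case/orP: (leq_total i j) => [/W|/W/esym]; auto.
  move/esym/eqP: ij; rewrite eqn_mod_dvd ?leq_mul2l ?lij ?orbT//.
  rewrite -mulnBr Gauss_dvdr// => /dvdnP[q qE]; have := ltn_ord j.
  by case: q qE => [|q] qE; lia.
rewrite [RHS](reindex_inj hinj)/=; apply: eq_bigr => k _.
by rewrite hE fd.
Qed.

(** The factor [c n] erases the coordinates at non-invertible residues, so that matrices can be
    indexed by all of ['I_d]. *)
Definition residue_fun (v : 'rV[R]_d) (n : nat) : R :=
  c n * v 0 (inord (n %% d)).

Lemma residue_fun_mod (v : 'rV[R]_d) n : residue_fun v (n %% d)%N = residue_fun v n.
Proof. by rewrite /residue_fun c_mod modn_mod. Qed.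

Let phi : R := \sum_(0 <= r < d) c r.

Let phi_gt0 : 0 < phi.
Proof.
rewrite /phi (@big_cat_nat _ _ _ (1 %% d))//= ?(ltnW (ltn_pmod _ _))//.
rewrite [X in _ + X]big_ltn ?ltn_pmod// c_mod cE ?coprimen1//.
by rewrite addrCA ltr_pwDl ?addr_ge0 ?sumr_ge0.
Qed.

Let phi_neq0 : phi != 0. Proof. by rewrite gt_eqF. Qed.

Definition residue_mean (v : 'rV[R]_d) : R :=
  (\sum_(r < d) c r * v 0 r) / phi.

(** The basis vector at r minus its mean, cut to the invertible residues; it vanishes identically
    when r is not invertible. *)
Definition centred_class (r : 'I_d) (n : nat) : R :=
  c n * ((n %% d == r)%N%:R - c r / phi).

Lemma centred_class_zero_mean r : zero_mean d (centred_class r).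
Proof.
split=> [n|m]; first by rewrite /centred_class c_mod modn_mod.
have [dm|dm] := boolP (coprime d m); last first.
  by rewrite big1// => k _; rewrite /centred_class cM (cN dm) !mul0r.
rewrite (sum_dilate_coprime _ dm) => [|n]; last first.
  by rewrite /centred_class c_mod modn_mod.
rewrite /centred_class.
under eq_bigr do rewrite mulrBr.
rewrite sumrB -mulr_suml -/phi mulrCA mulfV// mulr1 big_mkord (bigD1 r)//=.
rewrite modn_small// eqxx mulr1 big1 ?addr0 ?subrr// => i ir.
by rewrite modn_small// (negbTE (ir : val i != val r)) mulr0.
Qed.

Lemma sum_centred_class (v : 'rV[R]_d) n :
  \sum_(r < d) v 0 r * centred_class r n =
  residue_fun v n - residue_mean v * c n.
Proof.
have -> : residue_fun v n = \sum_(r < d) v 0 r * (c n * (n %% d == r)%N%:R).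
  rewrite (bigD1 (inord (n %% d)))//= inordK ?ltn_pmod// eqxx mulr1.
  rewrite big1 ?addr0 1?mulrC// => r rn.
  case: eqVneq => [nr|]; last by rewrite !mulr0.
  by move: rn; rewrite nr inord_val eqxx.
rewrite /residue_mean 2!mulr_suml -sumrB; apply: eq_bigr => r _.
by rewrite /centred_class; ring.
Qed.

Lemma dirichlet_value_sum (v : 'rV[R]_d) m :
  dirichlet_value (fun n => \sum_(r < d) v 0 r * centred_class r (m * n)) =
  \sum_(r < d) v 0 r * dirichlet_value (fun n => centred_class r (m * n)).
Proof.
rewrite /dirichlet_value.
under [in LHS]eq_fun => N.
  under eq_bigr do rewrite mulr_suml.
  rewrite exchange_big/=.
  under eq_bigr do (under eq_bigr do rewrite -mulrA; rewrite -mulr_sumr).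
  over.
apply: cvg_lim => //; apply: cvg_big => [|r _].
  by move=> x y; exact: add_continuous.
apply: cvgM; first exact: cvg_cst.
have [C C0 gC] := zero_mean_bound d0 (centred_class_zero_mean r).
by have [] := dirichlet_value_rate C0 (gC m).
Qed.

(* On mean-zero functions [v] of the invertible residues this is the operator
   [m |-> \sum_n v (m n) / n]; constants and the non-invertible residues are
   fixed. *)
Definition dirichlet_mx : 'M[R]_d := \matrix_(r, m)
  if coprime d m
  then dirichlet_value (fun n => centred_class r (m * n)) + c r / phi
  else (r == m)%:R.

Let A := dirichlet_mx.

Lemma dirichlet_mxE (v : 'rV[R]_d) (m : 'I_d) : coprime d m ->
  (v *m A) 0 m = dirichlet_value (fun n => residue_fun v (m * n)%N -
                                 residue_mean v * c (m * n)%N) + residue_mean v.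
Proof.
move=> dm; rewrite mxE.
under eq_bigr do rewrite mxE dm mulrDr.
rewrite big_split/= -dirichlet_value_sum; congr (_ + _).
  by congr dirichlet_value; apply/funext => n; rewrite sum_centred_class.
rewrite /residue_mean mulr_suml; apply: eq_bigr => r _.
by rewrite mulrA [v 0 r * _]mulrC.
Qed.

Lemma dirichlet_mx_noncoprime (v : 'rV[R]_d) (m : 'I_d) : ~~ coprime d m ->
  (v *m A) 0 m = v 0 m.
Proof.
move=> dm; rewrite mxE.
under eq_bigr do rewrite mxE (negbTE dm).
rewrite (bigD1 m)//= eqxx mulr1 big1 ?addr0// => r /negbTE ->.
by rewrite mulr0.
Qed.

(** For m invertible, the dilate of [v *m A] is a value of L, of density 0, plus the mean of v times
    the indicator of the invertible residues, of density 1. *)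
Lemma log_density_image (v : 'rV[R]_d) m :
  log_density (fun n => residue_fun (v *m A) (m * n)%N) (c m * residue_mean v).
Proof.
have [dm|dm] := boolP (coprime d m); last first.
  rewrite (cN dm) mul0r; apply: eq_log_density (log_density0 R) => n _.
  by rewrite /residue_fun cM (cN dm) !mul0r.
rewrite (cE dm) mul1r.
have H r : log_density (fun n =>
    v 0 r * (dirichlet_value (fun k => centred_class r (m * (n * k))%N) +
             c r / phi * c n)) (v 0 r * (0 + c r / phi * 1)).
  apply: log_densityZ; apply: log_densityD.
    apply: (@log_density_dirichlet_value _ _ d0 (fun k => centred_class r (m * k)%N)).
    exact: zero_mean_dilate (centred_class_zero_mean r).
  by apply: log_densityZ; exact: log_density_coprime.
have := log_density_sum (index_enum 'I_d) H.
have -> : \sum_(r <- index_enum 'I_d) v 0 r * (0 + c r / phi * 1) = residue_mean v.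
  rewrite /residue_mean mulr_suml; apply: eq_bigr => r _; ring.
apply: eq_log_density => n _.
rewrite /residue_fun mxE mulr_sumr; apply: eq_bigr => r _; rewrite mxE.
rewrite inordK ?ltn_pmod// coprime_modr.
rewrite cM (cE dm) mul1r coprimeMr dm/=.
have [dn|dn] := boolP (coprime d n).
  rewrite (cE dn) mul1r mulr1; congr (_ * (_ + _)).
  congr dirichlet_value; apply/funext => k.
  have [zm _] := centred_class_zero_mean r.
  by rewrite mulnA -[LHS]zm -[RHS]zm modnMml.
rewrite (cN dn) mul0r mulr0 addr0.
rewrite (_ : (fun k => _) = fun=> 0); last first.
  by apply/funext => k; rewrite /centred_class !cM (cN dn) !(mul0r, mulr0).
rewrite /dirichlet_value (_ : (fun N => _) = fun=> 0) ?lim_cst ?mulr0//.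
by apply/funext => N; rewrite big1// => k _; rewrite mul0r.
Qed.

Lemma sum_residue_fun (v : 'rV[R]_d) : \sum_(0 <= k < d) residue_fun v k = phi * residue_mean v.
Proof.
rewrite /residue_mean mulrCA mulfV// mulr1 big_mkord.
by apply: eq_bigr => r _; rewrite /residue_fun inord_modn.
Qed.

(** Add the densities of the dilates by all residues m: [log_density_image] gives phi times the mean
    of v, while for a fixed invertible n the dilates add up to phi times the mean of [v *m A]. *)
Lemma residue_mean_image (v : 'rV[R]_d) : residue_mean (v *m A) = residue_mean v.
Proof.
apply: (mulfI phi_neq0).
have H1 := log_density_sum (index_iota 0 d) (log_density_image v).
rewrite -mulr_suml -/phi in H1; apply: log_density_unique _ H1.
rewrite -[X in log_density _ X]mulr1.
apply: eq_log_density (log_densityZ _ (log_density_coprime R d0)) => n _.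
rewrite -sum_residue_fun -/(c n).
have [dn|dn] := boolP (coprime d n).
  rewrite (cE dn) mulr1 -(sum_dilate_coprime (residue_fun_mod _) dn).
  by apply: eq_bigr => k _; rewrite mulnC.
rewrite (cN dn) mulr0 big1// => k _.
by rewrite /residue_fun cM (cN dn) mulr0 mul0r.
Qed.

(** A fixes the non-invertible coordinates and preserves the mean, so both vanish on the kernel, and
    there A acts as L. *)
Lemma kermx_dirichletP {v : 'rV[R]_d} :
  reflect [/\ forall m : 'I_d, ~~ coprime d m -> v 0 m = 0,
              residue_mean v = 0 &
              forall m, dirichlet_value (fun n => residue_fun v (m * n)%N) = 0]
          (v <= kermx A)%MS.
Proof.
apply: (iffP sub_kermxP) => [vA|[v0 mv Lv]].
  have v0 (m : 'I_d) : ~~ coprime d m -> v 0 m = 0.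
    by move=> dm; rewrite -(dirichlet_mx_noncoprime _ dm) vA mxE.
  have mv : residue_mean v = 0.
    rewrite -residue_mean_image vA /residue_mean big1 ?mul0r// => r _.
    by rewrite mxE mulr0.
  split => // m; have [dm|dm] := boolP (coprime d m); last first.
    rewrite /dirichlet_value (_ : (fun N => _) = fun=> 0) ?lim_cst//.
    apply/funext => N; rewrite big1// => k _.
    by rewrite /residue_fun cM (cN dm) !mul0r.
  have dm' : coprime d (inord (m %% d) : 'I_d).
    by rewrite inordK ?ltn_pmod// coprime_modr.
  have := dirichlet_mxE v dm'; rewrite vA mxE mv addr0 => ->.
  congr dirichlet_value; apply/funext => k; rewrite mul0r subr0.
  rewrite inordK ?ltn_pmod// -[LHS]residue_fun_mod -[RHS]residue_fun_mod.
  by rewrite modnMml.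
apply/rowP => m; rewrite [RHS]mxE.
have [dm|dm] := boolP (coprime d m); last by rewrite dirichlet_mx_noncoprime// v0.
rewrite dirichlet_mxE// mv addr0 -[RHS](Lv m).
by congr dirichlet_value; apply/funext => n; rewrite mul0r subr0.
Qed.

Lemma residue_fun_zero_mean (v : 'rV[R]_d) : residue_mean v = 0 -> zero_mean d (residue_fun v).
Proof.
move=> mv; split=> [n|m]; first exact: residue_fun_mod.
have [dm|dm] := boolP (coprime d m); last first.
  by rewrite big1// => k _; rewrite /residue_fun cM (cN dm) !mul0r.
by rewrite (sum_dilate_coprime (residue_fun_mod v) dm) sum_residue_fun mv mulr0.
Qed.

Lemma log_density_kermx (v : 'rV[R]_d) m : (v <= kermx A)%MS ->
  log_density (fun n => residue_fun v (m * n)%N) (- residue_fun v m).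
Proof.
move=> /kermx_dirichletP[_ mv Lv]; rewrite -[in X in log_density _ X](muln1 m).
apply: (@log_density_kernel _ _ d0 (fun n => residue_fun v (m * n)%N)).
  exact: zero_mean_dilate (residue_fun_zero_mean mv).
move=> k _; rewrite -[RHS](Lv (m * k)%N); congr dirichlet_value.
by apply/funext => n; rewrite mulnA.
Qed.

(* For [w] in both spaces the dilate [n |-> w (m n)] has density [- w m] by
   [log_density_kermx] and density [0] by [log_density_image]. *)
Lemma capmx_ker_image : (kermx A :&: A = 0)%MS.
Proof.
apply/eqP; rewrite -submx0; apply/rV_subP => w.
rewrite sub_capmx => /andP[wK /submxP[v wE]].
have [w0 mw _] := kermx_dirichletP wK.
have mv : residue_mean v = 0 by rewrite -residue_mean_image -wE.
rewrite submx0; apply/eqP/rowP => m; rewrite [RHS]mxE.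
have [dm|dm] := boolP (coprime d m); last exact: w0.
have H := log_density_image v m; rewrite -wE mv mulr0 in H.
have := log_density_unique H (log_density_kermx m wK).
by rewrite /residue_fun inord_modn (cE dm) mul1r => /esym/eqP; rewrite oppr_eq0 => /eqP.
Qed.

Let P := proj_mx (kermx A) A.

Lemma addsmx_ker_image : (1%:M <= kermx A + A)%MS.
Proof.
rewrite sub1mx /row_full (mxrank_disjoint_sum capmx_ker_image) mxrank_ker.
by rewrite subnK// rank_leq_row.
Qed.

Lemma row_decomposition (v : 'rV[R]_d) :
  exists2 w, v = v *m P + w *m A & (v *m P <= kermx A)%MS.
Proof.
have vS : (v <= kermx A + A)%MS by apply: submx_trans (submx1 v) addsmx_ker_image.
have /submxP[w wE] := proj_mx_compl_sub vS.
by exists w; rewrite ?proj_mx_sub// -wE addrC subrK.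
Qed.

(* The diagonal entry [P r r] is bounded because the class of [1] has
   nonnegative logarithmic density. *)
Lemma diag_proj_le (r : 'I_d) : P r r <= c r / phi.
Proof.
pose e : 'rV[R]_d := delta_mx 0 r.
have [w eE eK] := row_decomposition e.
have PE : (e *m P) 0 r = P r r by rewrite -rowE mxE.
have [k0 mk _] := kermx_dirichletP eK.
have [dr|dr] := boolP (coprime d r); last by rewrite (cN dr) mul0r -PE k0.
have H := log_densityD (log_density_kermx r eK) (log_density_image w r).
have me : residue_mean e = phi^-1.
  rewrite /residue_mean (bigD1 r)//= mxE !eqxx (cE dr) !mul1r big1 ?addr0 ?mul1r//.
  by move=> i /negbTE ir; rewrite mxE ir andbF mulr0.
have mD (x y : 'rV[R]_d) : residue_mean (x + y) = residue_mean x + residue_mean y.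
  rewrite /residue_mean -mulrDl -big_split/=; congr (_ / _); apply: eq_bigr => i _.
  by rewrite mxE mulrDr.
have mw : residue_mean w = phi^-1.
  by rewrite -residue_mean_image -me eE mD mk add0r.
(* The two dilates add up to n |-> e (r n) cut to the invertible residues, a nonnegative function:
   the indicator of the class of 1. *)
have : 0 <= - residue_fun (e *m P) r + c r * residue_mean w.
  apply: log_density_ge0 H => n; rewrite /residue_fun -mulrDr.
  rewrite -[X in _ * X]/(_ + _) (_ : _ + _ = e 0 (inord (r * n %% d))); last first.
    by have /rowP/(_ (inord ((r * n) %% d))) := eE; rewrite [X in _ = X]mxE.
  by rewrite mulr_ge0// mxE.
by rewrite /residue_fun inord_modn PE mw (cE dr) !mul1r; lra.
Qed.

Lemma rank_kermx_le1 : (\rank (kermx A) <= 1)%N.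
Proof.
have PP : P *m P = P by apply: proj_mx_proj; exact: capmx_ker_image.
apply: (@leq_trans (\rank P)).
  by rewrite -{1}(proj_mx_id capmx_ker_image (submx_refl (kermx A))) mxrankM_maxr.
rewrite -(ler_nat R) -(mxtrace_idempotent PP).
apply: le_trans (_ : \sum_(r < d) c r / phi <= _).
  by apply: ler_sum => r _; exact: diag_proj_le.
by rewrite -mulr_suml -(big_mkord xpredT c) -/phi divff.
Qed.

Lemma translate_kermx (v : 'rV[R]_d) r : (v <= kermx A)%MS -> coprime d r ->
  exists2 u : 'rV[R]_d, (u <= kermx A)%MS &
    forall n, residue_fun u n = residue_fun v (r * n)%N.
Proof.
move=> vK dr; have [v0 mv Lv] := kermx_dirichletP vK.
pose u : 'rV[R]_d := \row_m residue_fun v (r * m)%N.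
have uE n : residue_fun u n = residue_fun v (r * n)%N.
  rewrite /residue_fun mxE inordK ?ltn_pmod// /residue_fun !cM (c_mod n) (cE dr).
  by rewrite !mul1r mulrA cc modnMmr.
exists u => //; apply/kermx_dirichletP; split.
- by move=> m dm; rewrite mxE /residue_fun cM (cN dm) mulr0 mul0r.
- apply: (mulfI phi_neq0); rewrite mulr0 -sum_residue_fun.
  under eq_bigr do rewrite uE.
  by rewrite (sum_dilate_coprime (residue_fun_mod v) dr) sum_residue_fun mv mulr0.
- move=> m; rewrite -[RHS](Lv (r * m)%N); congr dirichlet_value.
  by apply/funext => n; rewrite uE mulnA.
Qed.

(** Dilation by a unit m preserves the kernel, a line, and so multiplies its generator u by a scalar
    u m / u 1. These scalars form the character. *)
Lemma exceptional_character : kermx A != 0 -> exists chi : nat -> R,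
  [/\ zero_mean d chi, dirichlet_value chi = 0, chi 1%N = 1,
      forall m n, chi (m * n)%N = chi m * chi n &
      forall n, [\/ chi n = 0, chi n = 1 | chi n = -1]].
Proof.
move=> K0; have /rowV0Pn[v vK v_neq0] : kermx A != 0 by [].
have [v0 _ _] := kermx_dirichletP vK.
have [r vr] : exists r, v 0 r != 0.
  apply/existsP; rewrite -negb_forall; apply: contra v_neq0 => /forallP H.
  by apply/eqP/rowP => r; rewrite mxE; apply/eqP.
have dr : coprime d r by apply: contraNT vr => /v0 ->.
(* Dilating by a residue where v does not vanish makes the generator nonzero at 1. *)
have [u uK uE] := translate_kermx vK dr.
have u1 : residue_fun u 1 != 0.
  by rewrite uE muln1 /residue_fun inord_modn (cE dr) mul1r.
have [_ mu Lu] := kermx_dirichletP uK.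
have u_neq0 : u != 0.
  by apply: contraNneq u1 => ->; rewrite /residue_fun mxE mulr0.
have mult m n : residue_fun u (m * n)%N * residue_fun u 1 = residue_fun u m * residue_fun u n.
  have [dm|dm] := boolP (coprime d m); last first.
    by rewrite /residue_fun cM (cN dm) !mul0r.
  have [w wK wE] := translate_kermx uK dm.
  have Ku : (kermx A <= u)%MS.
    rewrite -(geq_leqif (mxrank_leqif_sup uK)) rank_rV u_neq0.
    exact: rank_kermx_le1.
  have /sub_rVP[a wa] := submx_trans wK Ku.
  have wf k : residue_fun w k = a * residue_fun u k.
    by rewrite /residue_fun wa mxE; ring.
  by rewrite -wE wf -[in RHS](muln1 m) -wE wf; ring.
pose chi n := residue_fun u n / residue_fun u 1.
have chi1 : chi 1%N = 1 by rewrite /chi divff.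
have chiM m n : chi (m * n)%N = chi m * chi n.
  rewrite /chi mulrACA -mult mulrACA mulrA [_ / _ * _]mulrAC.
  by rewrite mulrK ?unitfE// mulrAC -mulrA mulfV ?mulr1.
have [zu1 zu2] := residue_fun_zero_mean mu.
exists chi; split => //.
- split=> [n|m]; first by rewrite /chi zu1.
  by rewrite -mulr_suml zu2 mul0r.
- have [C C0 gC] := zero_mean_bound d0 (residue_fun_zero_mean mu).
  have [cu _] := dirichlet_value_rate C0 (gC 1%N).
  rewrite /dirichlet_value (_ : (fun N => _) = fun N =>
     (residue_fun u 1)^-1 * \sum_(1 <= k < N.+1) residue_fun u (1 * k) / k%:R).
    rewrite (cvg_lim _ (cvgM (cvg_cst _) cu))//.
    by have := Lu 1%N; rewrite /dirichlet_value => ->; rewrite mulr0.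
  apply/funext => N; rewrite mulr_sumr; apply: eq_bigr => k _.
  by rewrite mul1n /chi; ring.
- move=> n; have [dn|dn] := boolP (coprime d n); last first.
    by apply: Or31; rewrite /chi /residue_fun (cN dn) !mul0r.
  have chiX k : chi (n ^ k)%N = chi n ^+ k.
    by elim: k => [|k IH]; rewrite ?expn0 ?expr0// expnS exprS chiM IH.
  (* By Euler's theorem chi n is a real root of unity. *)
  have : `|chi n| ^+ totient d == 1.
    rewrite -normrX -chiX /chi -zu1.
    rewrite (Euler_exp_totient (_ : coprime n d)) ?(coprime_sym n)//.
    by rewrite zu1 divff ?normr1.
  rewrite pexpr_eq1 ?totient_gt0// eqr_norml ler01 andbT.
  by move=> /orP[/eqP|/eqP]; [apply: Or32 | apply: Or33].
Qed.

(** With trivial kernel the indicator of the class is in the image of A, and its density is its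
    mean. *)
Lemma log_density_class h : kermx A = 0 -> coprime d h ->
  exists2 a : R, 0 < a & log_density (fun n => (n %% d == h %% d)%N%:R) a.
Proof.
move=> K0 dh; pose r : 'I_d := inord (h %% d).
have rE : r = (h %% d)%N :> nat by rewrite inordK// ltn_pmod.
pose e : 'rV[R]_d := delta_mx 0 r.
have [w eE eK] := row_decomposition e.
have eP : e *m P = 0 by apply/eqP; rewrite -submx0 -K0.
have {}eE : e = w *m A by rewrite {1}eE eP add0r.
exists (residue_mean w).
  rewrite -residue_mean_image -eE /residue_mean divr_gt0// (bigD1 r)//=.
  rewrite mxE !eqxx mulr1 rE c_mod (cE dh) ltr_pwDl// sumr_ge0// => i _.
  by rewrite mulr_ge0// mxE.
have := log_density_image w 1; rewrite (cE (coprimen1 d)) mul1r -eE.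
apply: eq_log_density => n _; rewrite mul1n /residue_fun mxE eqxx/=.
rewrite -val_eqE/= inordK ?ltn_pmod// rE.
case: eqVneq => [nh|]; last by rewrite mulr0.
by rewrite mulr1 cE// -coprime_modr nh coprime_modr.
Qed.

End Residues.

(** * Monsky's argument *)

Section SignCharacter.
Variables (R : realType) (chi : nat -> R).
Hypotheses (chi1 : chi 1%N = 1)
  (chiM : forall m n, chi (m * n)%N = chi m * chi n)
  (chi_sgn : forall n, [\/ chi n = 0, chi n = 1 | chi n = -1]).

Lemma divisor_sum_chi_step p k m :
    prime p -> ~~ (p %| m)%N -> (0 < m)%N ->
  divisor_sum chi (p ^ k.+1 * m)%N =
  divisor_sum chi m + chi p * divisor_sum chi (p ^ k * m)%N.
Proof.
move=> pp pm m0; rewrite divisor_sum_pfactor//; congr (_ + _).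
rewrite /divisor_sum mulr_sumr.
by apply: eq_bigr => e _; rewrite chiM.
Qed.

Lemma divisor_sum_chi1 : divisor_sum chi 1 = 1.
Proof. by rewrite /divisor_sum big_mkcond big_nat1. Qed.

Lemma divisor_sum_chi_pfactor p m : prime p -> ~~ (p %| m)%N -> (0 < m)%N ->
  forall k, exists2 a : R, 0 <= a /\ (~~ odd k -> 1 <= a) &
    divisor_sum chi (p ^ k * m)%N = a * divisor_sum chi m.
Proof.
move=> pp pm m0.
(* The local factor is \sum_(i <= k) chi p ^ i. For chi p = -1 the recursion a |-> 1 - a preserves
   the sign only through the exact values 0 and 1, so these enter the induction. *)
suff H k : exists2 a : R, 0 <= a /\ (~~ odd k -> 1 <= a) /\
    (chi p = -1 -> a = (~~ odd k)%:R) &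
    divisor_sum chi (p ^ k * m)%N = a * divisor_sum chi m.
  by move=> k; have [a [a0 [a1 _]] aE] := H k; exists a.
elim: k => [|k [a [a0 [a1 aN]] aE]]; first by exists 1; rewrite ?mul1n ?mul1r.
exists (1 + chi p * a); last first.
  by rewrite divisor_sum_chi_step// aE mulrDl mul1r mulrA.
have [->|->|cp] := chi_sgn p.
- rewrite mul0r addr0; split=> //; split=> // /eqP.
  by rewrite eq_sym oppr_eq0 oner_eq0.
- rewrite mul1r; split; first by rewrite addr_ge0.
  split=> [_|/eqP]; first by rewrite lerDl.
  by rewrite -subr_eq0 opprK (_ : 1 + 1 = 2%:R) ?pnatr_eq0// -natr1.
- rewrite cp (aN cp) /=; case: (odd k) => /=;
    rewrite ?mulr0 ?addr0 ?mulr1 ?subrr; split=> //.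
Qed.

Lemma divisor_sum_chi_ge0 n : (0 < n)%N -> 0 <= divisor_sum chi n.
Proof.
move: n; apply: pfactor_ind => [|p k m pp pm m0 IH].
  by rewrite divisor_sum_chi1.
have [a [a0 _] ->] := divisor_sum_chi_pfactor pp pm m0 k.+1.
exact: mulr_ge0.
Qed.

Lemma divisor_sum_chi_square n : (0 < n)%N -> 1 <= divisor_sum chi (n ^ 2).
Proof.
move: n; apply: pfactor_ind => [|p k m pp pm m0 IH].
  by rewrite divisor_sum_chi1.
have pm2 : ~~ (p %| m ^ 2)%N by rewrite Euclid_dvdX// (negbTE pm).
have m20 : (0 < m ^ 2)%N by rewrite expn_gt0 m0.
rewrite expnMn -expnM.
have [a [_ a1] ->] := divisor_sum_chi_pfactor pp pm2 m20 (k.+1 * 2)%N.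
have {}a1 : 1 <= a by apply: a1; rewrite oddM andbF.
by rewrite -[X in X <= _]mulr1 ler_pM.
Qed.

End SignCharacter.

(** * Geometric sums and Monsky's weights *)

Section GeometricSums.
Variables (R : realType) (z : R).
Hypotheses (z0 : 0 < z) (z1 : z < 1).

Definition geom_sum (n : nat) : R := \sum_(0 <= i < n) z ^+ i.

Lemma geom_sumS n : geom_sum n.+1 = geom_sum n + z ^+ n.
Proof. by rewrite /geom_sum big_nat_recr. Qed.

Lemma geom_sumSl n : geom_sum n.+1 = 1 + z * geom_sum n.
Proof.
rewrite /geom_sum big_nat_recl// expr0 mulr_sumr; congr (_ + _).
by apply: eq_bigr => i _; rewrite exprS.
Qed.

Lemma geom_sumE n : (1 - z) * geom_sum n = 1 - z ^+ n.
Proof.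
have := geom_sumS n; rewrite geom_sumSl => H.
by have := congr1 (fun x => x - z ^+ n - z * geom_sum n) H; lra.
Qed.

Lemma geom_sum_gt0 n : (0 < n)%N -> 0 < geom_sum n.
Proof.
case: n => // n _; rewrite geom_sumSl ltr_pwDl// mulr_ge0 ?(ltW z0)//.
by apply: sumr_ge0 => i _; rewrite exprn_ge0// ltW.
Qed.

Lemma bernoulli_le n : 1 - n%:R * (1 - z) <= z ^+ n.
Proof.
elim: n => [|n IH]; first by rewrite mul0r subr0 expr0.
have h : 0 <= n%:R :> R by [].
rewrite exprS; have := ler_wpM2l (ltW z0) IH; rewrite -natr1.
have : 0 <= n%:R * (1 - z) * (1 - z) by rewrite !mulr_ge0// subr_ge0 ltW.
lra.
Qed.

Lemma geom_sum_ge n : n%:R - n%:R * (n%:R - 1) / 2 * (1 - z) <= geom_sum n.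
Proof.
elim: n => [|n IH]; first by rewrite /geom_sum big_geq// !mul0r subr0.
rewrite geom_sumS -natr1; have := bernoulli_le n; lra.
Qed.

(** The inequality behind [monsky_weight_decr]. Divided by z^n, the induction step becomes K below,
    for which the quadratic bound [geom_sum_ge] suffices. *)
Lemma geom_sum_mul_ge n : n%:R * n.+1%:R * z ^+ n <= geom_sum n * geom_sum n.+1.
Proof.
elim: n => [|n IH]; first by rewrite !mul0r /geom_sum big_geq// mul0r.
have zn : 0 <= z ^+ n by rewrite exprn_ge0// ltW.
have h : 0 <= n%:R :> R by [].
have G := geom_sum_ge n.+1.
rewrite [geom_sum n.+2]geom_sumS [in geom_sum n.+1 + _](geom_sumS n).
have -> : geom_sum n.+1 * (geom_sum n + z ^+ n + z ^+ n.+1) =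
   geom_sum n * geom_sum n.+1 + z ^+ n * (geom_sum n.+1 * (1 + z)).
  by rewrite exprS; ring.
apply: le_trans (lerD IH (lexx _)).
have K : n.+1%:R * n.+2%:R * z <= n%:R * n.+1%:R + geom_sum n.+1 * (1 + z).
  have z1' : 0 <= 1 + z by rewrite addr_ge0// ltW.
  have := ler_wpM2r z1' G; rewrite -(natr1 n.+1) -(natr1 n).
  have : 0 <= n%:R * (1 - z) * (1 - z) by rewrite !mulr_ge0// subr_ge0 ltW.
  have : 0 <= n%:R * n%:R * ((1 - z) * (1 - z)) by rewrite !mulr_ge0// subr_ge0 ltW.
  have : 0 <= n%:R * (1 - z) by rewrite mulr_ge0// subr_ge0 ltW.
  move: (geom_sum n.+1) (n%:R : R) h => s x h.
  set t := 1 - z; have -> : z = 1 - t by rewrite /t; ring.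
  have : 0 <= t by rewrite /t subr_ge0 ltW.
  nra.
have := ler_wpM2l zn K; rewrite exprS; lra.
Qed.

(* [(1 - z)] times Monsky's weights [1 / (n (1 - z)) - z ^ n / (1 - z ^ n)]. *)
Definition monsky_weight (n : nat) : R := n%:R^-1 - z ^+ n / geom_sum n.

Lemma monsky_weight_ge0 n : (0 < n)%N -> 0 <= monsky_weight n.
Proof.
move=> n0; rewrite /monsky_weight subr_ge0 ler_pdivrMr ?geom_sum_gt0//.
rewrite mulrC ler_pdivlMr ?ltr0n// mulr_natr.
rewrite -[X in _ *+ X]subn0 -sumr_const_nat; apply: ler_sum_nat => i /andP[_ lin].
by rewrite ler_wiXn2l ?(ltW z0) ?(ltW z1)// ltnW.
Qed.

Lemma monsky_weight_decr n : (0 < n)%N -> monsky_weight n.+1 <= monsky_weight n.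
Proof.
move=> n0; rewrite /monsky_weight.
have s0 := geom_sum_gt0 n0; have s1 := @geom_sum_gt0 n.+1 isT.
have n0' : 0 < n%:R :> R by rewrite ltr0n.
have n1 : 0 < n.+1%:R :> R by rewrite ltr0n.
rewrite -subr_ge0.
have -> : n%:R^-1 - z ^+ n / geom_sum n -
    (n.+1%:R^-1 - z ^+ n.+1 / geom_sum n.+1) =
    (n%:R * n.+1%:R)^-1 - z ^+ n / (geom_sum n * geom_sum n.+1).
  have E : z ^+ n * geom_sum n.+1 - z ^+ n.+1 * geom_sum n = z ^+ n.
    by rewrite geom_sumSl exprS; ring.
  have -> : z ^+ n / (geom_sum n * geom_sum n.+1) =
     (z ^+ n * geom_sum n.+1 - z ^+ n.+1 * geom_sum n) /
     (geom_sum n * geom_sum n.+1) by rewrite E.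
  move: (geom_sum n) (geom_sum n.+1) s0 s1 => s s' s0 s1.
  rewrite -(natr1 n) in n1 *.
  by field; rewrite !gt_eqF.
rewrite subr_ge0 ler_pdivrMr ?mulr_gt0// mulrC ler_pdivlMr ?mulr_gt0//.
by rewrite mulrC geom_sum_mul_ge.
Qed.

Lemma sum_expr_multiples e K : (0 < e)%N ->
  (1 - z ^+ e) * \sum_(1 <= k < K.+1) z ^+ (e * k) = z ^+ e - z ^+ (e * K.+1).
Proof.
move=> e0; elim: K => [|K IH]; first by rewrite big_geq// muln1 mulr0 subrr.
rewrite big_nat_recr//= mulrDr IH mulrBl mul1r -exprD -mulnS; ring.
Qed.

End GeometricSums.

(* If the value vanished, the Lambert series [\sum_n chi n z^n / (1 - z^n)]
   would stay bounded as [z] tends to 1, but it dominates [\sum_m z^(m^2)]. *)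
Lemma dirichlet_value_sign_character_neq0 (R : realType) (chi : nat -> R) (C : R) :
    chi 1%N = 1 -> (forall m n, chi (m * n)%N = chi m * chi n) ->
    (forall n, [\/ chi n = 0, chi n = 1 | chi n = -1]) ->
    0 <= C -> (forall n, `|\sum_(0 <= k < n) chi k| <= C) ->
  dirichlet_value chi != 0.
Proof.
move=> chi1 chiM chi_sgn C0 chiC; apply/eqP => L0.
have norm_chi n : `|chi n| <= 1.
  by have [->|->|->] := chi_sgn n; rewrite ?normr0 ?normrN ?normr1.
(* A finite form of Monsky's comparison. The three errors are the tail of the vanishing series, the
   Abel bound for the weights, and the truncation of the Lambert series at N. *)
have key (z : R) N M : 0 < z -> z < 1 -> (M ^ 2 <= N)%N -> (0 < N)%N ->
    (1 - z) * (\sum_(1 <= m < M.+1) z ^+ (m ^ 2)) <=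
    2 * C / N%:R + 2 * C * (1 - z) + N%:R * z ^+ N.
  move=> z0 z1 MN N0.
  have N0' : 0 < N%:R :> R by rewrite ltr0n.
  have zge n : 0 <= z ^+ n by rewrite exprn_ge0// ltW.
  have H1 : `|\sum_(1 <= n < N.+1) chi n / n%:R| <= 2 * C / N%:R.
    have [_ /(_ N)] := dirichlet_value_rate C0 chiC.
    rewrite L0 sub0r normrN => /le_trans; apply.
    by rewrite ler_wpM2l ?mulr_ge0// lef_pV2 ?posrE ?ltr0n// ler_nat.
  have H2 : `|\sum_(1 <= n < N.+1) chi n * monsky_weight z n| <= 2 * C * (1 - z).
    have -> : 1 - z = monsky_weight z 1.
      by rewrite /monsky_weight /geom_sum big_nat1 expr0 expr1 !invr1 mulr1.
    apply: (@abel_sum_bound R chi (monsky_weight z)) => // n n1.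
      exact: monsky_weight_ge0.
    exact: monsky_weight_decr.
  have H3 : \sum_(1 <= m < M.+1) z ^+ (m ^ 2) <=
      \sum_(1 <= n < N.+1) divisor_sum chi n * z ^+ n.
    have sqs m : (m <= M)%N -> \sum_(1 <= i < m.+1) z ^+ (i ^ 2) <=
        \sum_(1 <= n < (m ^ 2).+1) divisor_sum chi n * z ^+ n.
      elim: m => [|m IH] mM; first by rewrite !big_geq.
      rewrite big_nat_recr//= [leRHS](@big_cat_nat _ _ _ (m ^ 2).+1)//=; last first.
        by rewrite ltnS leq_sqr.
      apply: lerD; first exact: IH (ltnW mM).
      have lt : ((m ^ 2).+1 <= m.+1 ^ 2)%N by rewrite ltn_sqr.
      rewrite (@big_nat_recr _ _ _ (m.+1 ^ 2))//= -[X in X <= _]add0r lerD//.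
        rewrite big_nat_cond sumr_ge0// => n /andP[/andP[n1 _] _].
        rewrite mulr_ge0// divisor_sum_chi_ge0//; lia.
      by rewrite -[X in X <= _]mul1r ler_wpM2r// divisor_sum_chi_square.
    apply: le_trans (sqs M (leqnn _)) _.
    rewrite [leRHS](@big_cat_nat _ _ _ (M ^ 2).+1)//= lerDl.
    rewrite big_nat_cond sumr_ge0// => n /andP[/andP[n1 _] _].
    rewrite mulr_ge0// divisor_sum_chi_ge0//; lia.
  have H4 : \sum_(1 <= n < N.+1) divisor_sum chi n * z ^+ n =
    \sum_(1 <= e < N.+1) chi e * \sum_(1 <= k < (N %/ e).+1) z ^+ (e * k).
    under [RHS]eq_bigr do rewrite mulr_sumr.
    rewrite -(sum_divisor_sum (fun e k => chi e * z ^+ (e * k))).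
    apply: eq_bigr => n _; rewrite /divisor_sum mulr_suml; apply: eq_bigr.
    by move=> e en; rewrite mulnC divnK.
  (* Cutting the geometric series of ratio z^e after N / e terms leaves a remainder of at most z^N
     for each e. *)
  have H5 : `|(1 - z) * \sum_(1 <= e < N.+1) chi e *
        \sum_(1 <= k < (N %/ e).+1) z ^+ (e * k) -
      (\sum_(1 <= n < N.+1) chi n / n%:R -
       \sum_(1 <= n < N.+1) chi n * monsky_weight z n)| <= N%:R * z ^+ N.
    rewrite mulr_sumr -!sumrB; apply: le_trans (ler_norm_sum _ _ _) _.
    rewrite mulr_natl -[X in _ *+ X](subn0 N) -subSS -sumr_const_nat.
    apply: ler_sum_nat => e /andP[e0 eN].
    have s0 := geom_sum_gt0 z0 e0.
    have sE := geom_sumE z e.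
    have K := sum_expr_multiples z (N %/ e) e0.
    have s1 : 1 <= geom_sum z e.
      by case: (e) e0 => // e' _; rewrite geom_sumSl lerDl mulr_ge0 ?(ltW z0)// sumr_ge0.
    have -> : (1 - z) * (chi e * \sum_(1 <= k < (N %/ e).+1) z ^+ (e * k)) -
       (chi e / e%:R - chi e * monsky_weight z e) =
       - (chi e * (z ^+ (e * (N %/ e).+1) / geom_sum z e)).
      apply: (mulIf (lt0r_neq0 s0)); rewrite /monsky_weight.
      move: K; rewrite -sE; move: (\sum_(1 <= k < _) _) => S K.
      have -> : (- (chi e * (z ^+ (e * (N %/ e).+1) / geom_sum z e)) * geom_sum z e
        = - (chi e * z ^+ (e * (N %/ e).+1))).
        by rewrite mulNr -!mulrA mulVf ?mulr1 ?gt_eqF.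
      have -> : ((1 - z) * (chi e * S) -
          (chi e / e%:R - chi e * (e%:R^-1 - z ^+ e / geom_sum z e))) * geom_sum z e =
          chi e * ((1 - z) * geom_sum z e * S - z ^+ e / geom_sum z e * geom_sum z e).
        by ring.
      by rewrite K divfK ?gt_eqF//; ring.
    rewrite normrN normrM -[leRHS]mul1r ler_pM//.
    rewrite ger0_norm ?divr_ge0 ?(ltW s0)//.
    rewrite ler_pdivrMr//; apply: (@le_trans _ _ (z ^+ N)).
      rewrite ler_wiXn2l ?(ltW z0) ?(ltW z1)// mulnC ltnW// ltn_ceil//.
    by rewrite ler_peMr.
  have z1' : 0 <= 1 - z by rewrite subr_ge0 ltW.
  have := ler_wpM2l z1' H3; rewrite H4.
  move: H1 H2 H5; rewrite !ler_norml; lra.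
(* With 1 - z = t = 1 / (2 M^2), Bernoulli gives z^(m^2) >= 1/2 for m <= M, so the sum of squares is
   at least M / 2 > 2C + 1. It then suffices that the first and third errors together stay below
   t. *)
pose M := (Num.truncn (4 * C + 2)).+1.
have MC : 4 * C + 2 < M%:R by exact: truncnS_gt.
have M0 : 0 < M%:R :> R by rewrite ltr0n.
have M1 : 1 <= M%:R :> R by rewrite ler1n.
pose t : R := (2 * M%:R ^+ 2)^-1.
have t0 : 0 < t by rewrite invr_gt0 mulr_gt0// exprn_gt0.
have tM : t * M%:R ^+ 2 = 1 / 2.
  by rewrite /t invfM -mulrA mulVf ?mulr1 ?div1r// gt_eqF// exprn_gt0.
have t1 : t <= 1 / 2.
  by rewrite -tM ler_peMr ?(ltW t0)// -[leLHS](expr1n _ 2) lerXn2r ?nnegrE// ltW.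
pose z := 1 - t.
have z0 : 0 < z by rewrite /z; lra.
have z1 : z < 1 by rewrite /z; lra.
have S : M%:R / 2 <= \sum_(1 <= m < M.+1) z ^+ (m ^ 2).
  have -> : M%:R / 2 = \sum_(1 <= m < M.+1) (1 / 2 : R).
    by rewrite sumr_const_nat subSS subn0 div1r mulr_natl.
  apply: ler_sum_nat => m /andP[_ mM]; apply: le_trans (bernoulli_le z0 z1 _).
  have : (m ^ 2)%:R <= M%:R ^+ 2 :> R by rewrite natrX lerXn2r ?nnegrE// ler_nat.
  move=> /(ler_wpM2l (ltW t0)); rewrite tM /z; lra.
(* The truncation is N = 3L. From z^L <= 1 / (L t) one gets N z^N <= 3 / (t^3 L^2), and L > B brings
   the two errors below t. *)
pose B := t^-1 * (2 * C + 3 / (t * t * t)).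
pose L := (Num.truncn B + M ^ 2).+1.
have Lgt0 : 0 < L%:R :> R by rewrite ltr0n.
have LB : B < L%:R.
  by apply: lt_le_trans (truncnS_gt _) _; rewrite ler_nat ltnS leq_addr.
have zL : z ^+ (3 * L) <= (L%:R * t)^-1 ^+ 3.
  rewrite mulnC exprM lerXn2r ?nnegrE ?exprn_ge0 ?invr_ge0 ?mulr_ge0 ?(ltW z0) ?(ltW t0)//.
  rewrite -[leRHS]mul1r ler_pdivlMr ?mulr_gt0//.
  have zpos k : 0 < z ^+ k by exact: exprn_gt0.
  have bern k : z ^+ k * (1 + k%:R * t) <= 1.
    elim: k => [|k IH]; first by rewrite mul0r addr0 mulr1.
    apply: le_trans IH; rewrite exprS -natr1.
    have -> : z * z ^+ k * (1 + (k%:R + 1) * t) = z ^+ k * (z * (1 + (k%:R + 1) * t)) by ring.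
    rewrite ler_wpM2l ?(ltW (zpos k))// /z.
    have : 0 <= (k%:R + 1) * t * t by rewrite !mulr_ge0 ?addr_ge0 ?(ltW t0).
    lra.
  by apply: le_trans (bern L); rewrite ler_wpM2l ?(ltW (zpos L))//; lra.
have MN : (M ^ 2 <= 3 * L)%N.
  by apply: leq_trans (leq_pmull L (isT : (0 < 3)%N)); rewrite leqW// leq_addl.
have := key z (3 * L)%N M z0 z1 MN isT.
have zE : 1 - z = t by rewrite /z; ring.
rewrite zE; apply/negP; rewrite -ltNge.
apply: lt_le_trans (ler_wpM2l (ltW t0) S).
have T1 : 2 * C / (3 * L)%:R <= 2 * C / L%:R.
  by rewrite ler_wpM2l ?mulr_ge0// lef_pV2 ?posrE ?ltr0n// ler_nat leq_pmull.
have T2 : (3 * L)%:R * z ^+ (3 * L) <= 3 / (t * t * t) / L%:R.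
  apply: le_trans (ler_wpM2l (ler0n _ _) zL) _.
  have -> : (3 * L)%:R * (L%:R * t)^-1 ^+ 3 = 3 / (t * t * t) / (L%:R * L%:R).
    by rewrite natrM; field; rewrite !gt_eqF.
  rewrite ler_wpM2l ?divr_ge0 ?mulr_ge0 ?(ltW t0)//.
  by rewrite lef_pV2 ?posrE ?mulr_gt0// ler_peMr ?(ltW Lgt0)// ler1n.
have T3 : 2 * C / L%:R + 3 / (t * t * t) / L%:R < t.
  by rewrite -mulrDl ltr_pdivrMr// -ltr_pdivrMl.
have : t * (4 * C + 2) <= t * M%:R by rewrite ler_wpM2l ?(ltW t0)// ltW.
lra.
Qed.

(** * Primes in arithmetic progressions *)

Section PrimesInProgressions.
Variable R : realType.

Lemma ler_sum_nat_term (F : nat -> R) m n i : (forall k, 0 <= F k) ->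
  (m <= i < n)%N -> F i <= \sum_(m <= k < n) F k.
Proof.
move=> F0 /andP[mi lin]; rewrite (@big_cat_nat _ _ _ i)//= ?(ltnW lin)//.
by rewrite [X in _ + X]big_ltn// addrCA lerDl addr_ge0// sumr_ge0.
Qed.

Lemma sum_nat_eq_le1 a N : \sum_(1 <= n < N.+1) (n == a)%:R <= 1 :> R.
Proof.
suff -> : \sum_(1 <= n < N.+1) (n == a)%:R = (0 < a <= N)%N%:R :> R.
  by case: (_ && _).
elim: N => [|N IH]; first by rewrite big_geq//; case: a.
rewrite big_nat_recr//= IH -natrD; congr _%:R.
by case: (ltngtP N.+1 a) => h; lia.
Qed.

Lemma sum_inv_pow_le (p K : nat) : (2 <= p)%N ->
  \sum_(2 <= k < K.+2) (p%:R ^+ k)^-1 <= 2 / p%:R ^+ 2 :> R.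
Proof.
move=> p2; have p0 : 0 < p%:R :> R by rewrite ltr0n; lia.
apply: (@le_trans _ _ (2 / p%:R ^+ 2 - 2 / p%:R ^+ K.+2)); last first.
  by rewrite gerBl divr_ge0// exprn_ge0// ltW.
elim: K => [|K IH]; first by rewrite big_geq// subrr.
rewrite big_nat_recr//=; apply: le_trans (lerD IH (lexx _)) _.
have q0 : 0 < (p%:R ^+ K.+2)^-1 :> R by rewrite invr_gt0 exprn_gt0.
have : 2 / p%:R ^+ K.+3 <= (p%:R ^+ K.+2)^-1 :> R.
  rewrite exprS invfM mulrA ler_piMl ?(ltW q0)//.
  by rewrite ler_pdivrMr// mul1r ler_nat.
by move: (2 / p%:R ^+ K.+3) => y; lra.
Qed.

Lemma sum_ln_div_square_le N :
  \sum_(2 <= p < N.+1) ln p%:R / p%:R ^+ 2 <= 2 :> R.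
Proof.
case: N => [|N]; first by rewrite big_geq.
rewrite big_add1/=.
pose f n : R := - ((ln n%:R + 2) / n%:R).
apply: (@le_trans _ _ (\sum_(1 <= m < N.+1) (f m.+1 - f m))).
  apply: ler_sum_nat => m /andP[m0 _].
  by have := ln_div_square_le R m0; rewrite /f opprK addrC.
rewrite telescope_sumr// /f ln1 add0r opprK divr1 gerDr oppr_le0.
by rewrite divr_ge0// addr_ge0// ln_nat_ge0.
Qed.

Lemma von_mangoldt_nonprime n : (0 < n)%N -> ~~ prime n -> von_mangoldt R n != 0 ->
  exists p k, [/\ prime p, (2 <= k)%N, n = (p ^ k)%N & von_mangoldt R n = ln p%:R].
Proof.
move=> n0 npr; rewrite {1}/von_mangoldt.
case E : (primes n) => [|p [|q s]]; rewrite ?eqxx// => _.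
have /[!mem_primes]/and3P[pp _ pn] : p \in primes n by rewrite E mem_head.
have [m pm nE] := pfactor_coprime pp n0.
have m1 : m = 1%N.
  case: (ltngtP m 1) => // m1.
    by move: n0; rewrite nE; case: (m) m1.
  have : pdiv m \in primes n.
    by rewrite mem_primes pdiv_prime// n0 nE dvdn_mulr// pdiv_dvd.
  rewrite E inE => /eqP pE; move: pm.
  by rewrite prime_coprime// -pE pdiv_dvd.
exists p, (logn p n); split => //; last by rewrite /von_mangoldt E.
  case: (logn p n) nE => [|[|k]]//; rewrite m1 mul1n ?expn0 ?expn1 => nE.
    by move: pn; rewrite nE dvdn1 => /eqP p1; rewrite p1 in pp.
  by rewrite nE pp in npr.
by rewrite {1}nE m1 mul1n.
Qed.

(** Only the powers p^k with k >= 2 contribute, for each p at most 2 ln p / p^2, and the ln p / p^2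
    sum to at most 2. *)
Lemma sum_von_mangoldt_nonprime_le N :
  \sum_(1 <= n < N.+1 | ~~ prime n) von_mangoldt R n / n%:R <= 4.
Proof.
pose T n p k : R := (n == p ^ k)%N%:R * (ln p%:R / p%:R ^+ k).
have T0 n p k : 0 <= T n p k.
  by rewrite mulr_ge0// divr_ge0 ?ln_nat_ge0// exprn_ge0.
apply: (@le_trans _ _ (\sum_(1 <= n < N.+1)
    \sum_(2 <= p < N.+1) \sum_(2 <= k < N.+2) T n p k)).
  rewrite big_mkcond; apply: ler_sum_nat => n /andP[n0 nN].
  have S0 : 0 <= \sum_(2 <= p < N.+1) \sum_(2 <= k < N.+2) T n p k.
    by apply: sumr_ge0 => p _; apply: sumr_ge0.
  case: ifP => // npr; have [->|v0] := eqVneq (von_mangoldt R n) 0.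
    by rewrite mul0r.
  have [p [k [pp k2 nE ->]]] := von_mangoldt_nonprime n0 npr v0.
  have p2 := prime_gt1 pp.
  have kn : (k < n)%N by rewrite nE ltn_expl.
  have pn : (p <= n)%N by rewrite nE -{1}(expn1 p) leq_pexp2l//; lia.
  apply: (@le_trans _ _ (\sum_(2 <= l < N.+2) T n p l)); last first.
    apply: (@ler_sum_nat_term (fun p => \sum_(2 <= l < N.+2) T n p l)); last lia.
    by move=> q; apply: sumr_ge0.
  apply: (@le_trans _ _ (T n p k)).
    by rewrite /T -nE eqxx mul1r nE natrX.
  by apply: ler_sum_nat_term => //; lia.
rewrite exchange_big/=.
apply: (@le_trans _ _ (\sum_(2 <= p < N.+1) 2 * (ln p%:R / p%:R ^+ 2))); last first.
  by rewrite -mulr_sumr; have := sum_ln_div_square_le N; lra.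
apply: ler_sum_nat => p /andP[p2 _]; rewrite exchange_big/=.
apply: (@le_trans _ _ (\sum_(2 <= k < N.+2) ln p%:R / p%:R ^+ k)).
  apply: ler_sum_nat => k _; rewrite /T -mulr_suml.
  rewrite ler_piMl ?sum_nat_eq_le1// divr_ge0 ?ln_nat_ge0// exprn_ge0//.
rewrite -mulr_sumr mulrCA ler_wpM2l ?ln_nat_ge0//.
exact: sum_inv_pow_le.
Qed.

Lemma ker_dirichlet_mx_eq0 (D : nat) : kermx (dirichlet_mx R D) = 0.
Proof.
apply/eqP/negPn/negP => /exceptional_character[chi [zm L0 chi1 chiM chi_sgn]].
have [C C0 gC] := zero_mean_bound (isT : (0 < D.+1)%N) zm.
have : dirichlet_value chi != 0.
  apply: (dirichlet_value_sign_character_neq0 chi1 chiM chi_sgn C0) => n.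
  by have := gC 1%N n; under eq_bigr do rewrite mul1n.
by rewrite L0 eqxx.
Qed.

End PrimesInProgressions.

(** If all primes of the class were at most B, the weighted sum over the class would be at most K +
    4, whereas it grows like a ln N with a > 0. *)
Theorem dirichlet_primes (R : realType) (d h B : nat) : (0 < d)%N -> coprime d h ->
  exists p, [/\ prime p, (B < p)%N & p = h %[mod d]].
Proof.
case: d => // D _ dh; apply: contrapT => noP.
have smallP p : prime p -> p = h %[mod D.+1] -> (p <= B)%N.
  by move=> pp ph; rewrite leqNgt; apply/negP => Bp; apply: noP; exists p.
have [a a0 [C HC]] := log_density_class (ker_dirichlet_mx_eq0 R D) dh.
pose w n : R := von_mangoldt R n / n%:R.
have w0 n : 0 <= w n by rewrite divr_ge0// von_mangoldt_ge0.
pose K : R := \sum_(1 <= n < B.+1) w n.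
have [N N0 HN] := ln_nat_unbounded ((C + K + 4) / a).
have := HC N N0; rewrite ler_norml => /andP[+ _].
have : \sum_(1 <= n < N.+1) w n * (n %% D.+1 == h %% D.+1)%N%:R <= K + 4.
  apply: le_trans (lerD (_ : \sum_(1 <= n < N.+1 | (n <= B)%N) w n <= K)
                     (sum_von_mangoldt_nonprime_le R N)).
    rewrite [X in _ + X]big_mkcond [X in X + _]big_mkcond -big_split/=.
    apply: ler_sum_nat => n /andP[n0 nN].
    case: eqVneq => [nh|_]; last first.
      by rewrite mulr0 addr_ge0//; case: ifP => // _; exact: w0.
    rewrite mulr1; case: ifP => [_|/negbT nB]; first by rewrite lerDl; case: ifP => // _; exact: w0.
    rewrite add0r; case: ifP => // /negbFE /smallP/(_ nh) nB'.
    by rewrite nB' in nB.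
  case: (leqP N B) => NB.
    rewrite /K (@big_cat_nat _ _ _ N.+1 1 B.+1)//= ler_wpDr ?sumr_ge0//.
    by rewrite big_mkcond; apply: ler_sum_nat => n _; case: ifP.
  rewrite (@big_cat_nat _ _ _ B.+1)//=; last lia.
  rewrite [X in _ + X]big_nat_cond [X in _ + X]big1 ?addr0.
    by rewrite big_mkcond; apply: ler_sum_nat => n _; case: ifP.
  by move=> n; lia.
rewrite -/(w _) => H1 H2; move: HN; rewrite ltr_pdivrMr// => HN.
by move: H1 H2; rewrite /w; lra.
Qed.

(** * Residue classes avoiding shifted powers *)

Lemma PoszX (x j : nat) : (x ^ j)%N%:Z = x%:Z ^+ j.
Proof. by elim: j => // j IH; rewrite expnS exprS PoszM IH. Qed.

Lemma exprD_mod_square (r q : int) j : exists t : int,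
  (r + q) ^+ j.+1 = r ^+ j.+1 + j.+1%:Z * r ^+ j * q + q ^+ 2 * t.
Proof.
elim: j => [|j [t IH]]; first by exists 0; rewrite !expr1 expr0; ring.
exists (j.+1%:Z * r ^+ j + t * (r + q)).
rewrite exprSr IH (intS j.+1) (exprSr r j.+1) (exprSr r j); ring.
Qed.

(* A prime [q] dividing a value [i r^j + c] exactly once keeps the whole class
   of [r] modulo [q^2] away from [i' n^j'] with [j' >= 2]. *)
Lemma avoid_shifted_power (d h i j i' : nat) (c : int) :
    (0 < d)%N -> coprime d h -> (0 < i)%N -> (2 <= j)%N -> (0 < i')%N -> c != 0 ->
  exists d' h', [/\ (0 < d')%N, coprime d' h', (d %| d')%N, h' = h %[mod d] &
    forall x, x = h' %[mod d'] -> forall n j', (2 <= j')%N ->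
      (i * x ^ j)%:Z + c != (i' * n ^ j')%:Z].
Proof.
move=> d0 dh i0 j2 i'0 c0.
have [j'' jE] : exists j'', j = j''.+2 by exists j.-2; lia.
have ac0 : (0 < `|c|)%N by rewrite absz_gt0.
(* M collects everything q must be prime to. The extra factor 3 makes W = 3 T + 1 with T nonzero, so
   that W has a prime divisor. *)
pose M' := (d * i * i' * j * `|c|)%N; pose M := (3 * M')%N.
have M'0 : (0 < M')%N by rewrite !muln_gt0 d0 i0 i'0 ac0 !andbT /=; lia.
have M0 : (0 < M)%N by rewrite muln_gt0 M'0.
pose T : int := i%:Z * c ^+ j.-1 * M'%:Z * M%:Z ^+ j.-1.
have T0 : T != 0.
  by rewrite !mulf_neq0 ?expf_neq0//; lia.
(* At r = c M the value i r^j + c equals c W, and W is 1 modulo M: a prime divisor q of W divides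
   the value and is prime to M. *)
pose W : int := i%:Z * c ^+ j.-1 * M%:Z ^+ j + 1.
have WE : W = 3 * T + 1.
  rewrite /W /T jE /= (exprS M%:Z j''.+1) {1}/M PoszM; ring.
have W2 : (1 < `|W|)%N by move: T0; rewrite WE; lia.
have qp := pdiv_prime W2; set q := pdiv `|W| in qp.
have q0 := prime_gt0 qp.
have qW : (q%:Z %| W)%Z by rewrite dvdzE; exact: pdiv_dvd.
have qM : ~~ (q %| M)%N.
  apply/negP => qM; have : (q%:Z %| 1%R)%Z.
    have -> : 1%R = W - i%:Z * c ^+ j.-1 * M%:Z ^+ j by rewrite /W; ring.
    rewrite rpredB// dvdz_mull// jE exprS dvdz_mulr//.
  by rewrite dvdzE absz_nat absz1 dvdn1 => /eqP q1; rewrite q1 in qp.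
have qM' m : (m %| M)%N -> ~~ (q %| m)%N.
  by move=> mM; apply: contra qM => /dvdn_trans; apply.
have qd : ~~ (q %| d)%N by apply: qM'; rewrite /M /M' -!mulnA dvdn_mull// dvdn_mulr.
have qi : ~~ (q %| i)%N.
  by apply: qM'; rewrite /M /M' -!mulnA !(mulnCA _ i) dvdn_mulr.
have qi' : ~~ (q %| i')%N.
  by apply: qM'; rewrite /M /M' -!mulnA !(mulnCA _ i') dvdn_mulr.
have qj : ~~ (q %| j)%N.
  by apply: qM'; rewrite /M /M' -!mulnA !(mulnCA _ j) dvdn_mulr.
have qc : ~~ (q %| `|c|)%N by apply: qM'; rewrite /M /M' mulnA dvdn_mull.
pose r0 : nat := `|(c * M%:Z %% q%:Z)%Z|%N.
have r0E : r0%:Z = (c * M%:Z %% q%:Z)%Z.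
  by rewrite /r0 gez0_abs// modz_ge0//; lia.
have r0M : (q%:Z %| r0%:Z - c * M%:Z)%Z.
  by rewrite -eqz_mod_dvd r0E modz_mod.
have qr0 : ~~ (q %| r0)%N.
  apply/negP => qr; have : (q%:Z %| c * M%:Z)%Z.
    rewrite -(subrK r0%:Z (c * M%:Z)) rpredD//; first by rewrite -opprB rpredN.
  by rewrite dvdzE abszM !absz_nat Euclid_dvdM// (negbTE qc) /= (negbTE qM).
pose V (r : int) : int := i%:Z * r ^+ j + c.
have V0 : (q%:Z %| V r0)%Z.
  have -> : V r0 = i%:Z * (r0%:Z ^+ j - (c * M%:Z) ^+ j) + c * W.
    rewrite /V /W exprMn jE /= (exprS c j''.+1); ring.
  rewrite rpredD//; last exact: dvdz_mull.
  by rewrite dvdz_mull// subrXX dvdz_mulr.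
have Vq (r : int) : exists t, V (r + q%:Z) =
    V r + (i * j)%:Z * r ^+ j.-1 * q%:Z + q%:Z ^+ 2 * t.
  have [t tE] := exprD_mod_square r q j.-1; exists (i%:Z * t).
  by rewrite /V -[in LHS](prednK (_ : 0 < j)%N) ?tE ?prednK ?PoszM; [ring|lia|lia].
(* If q^2 divides the value at r0, pass to r0 + q: modulo q^2 the value changes by q times the
   derivative i j r0^(j-1), which is prime to q. *)
have [r [qr Vr Vr2]] : exists r : nat, [/\ ~~ (q %| r)%N,
     (q%:Z %| V r)%Z & ~~ (q%:Z ^+ 2 %| V r)%Z].
  case: (boolP (q%:Z ^+ 2 %| V r0)%Z) => [V2|]; last by exists r0.
  have [t tE] := Vq r0; exists (r0 + q)%N; rewrite PoszD tE; split.
  - by rewrite dvdn_addl.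
  - apply: rpredD; last by rewrite expr2 -mulrA dvdz_mulr ?dvdzz.
    by apply: rpredD => //; rewrite dvdz_mull ?dvdzz.
  - apply/negP => Hd.
    have : (q%:Z * q%:Z %| (i * j)%:Z * r0%:Z ^+ j.-1 * q%:Z)%Z.
      have -> : (i * j)%:Z * r0%:Z ^+ j.-1 * q%:Z = V r0 +
        (i * j)%:Z * r0%:Z ^+ j.-1 * q%:Z + q%:Z ^+ 2 * t - V r0 - q%:Z ^+ 2 * t by ring.
      by rewrite -expr2 !rpredB// dvdz_mulr ?dvdzz.
    rewrite dvdz_mul2r; last by lia.
    rewrite dvdzE !abszM abszX !absz_nat Euclid_dvdM// Euclid_dvdM// Euclid_dvdX//.
    by rewrite (negbTE qi) (negbTE qj) (negbTE qr0).
have dq : coprime d (q ^ 2) by rewrite coprimeXr// coprime_sym prime_coprime.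
exists (d * q ^ 2)%N, (chinese d (q ^ 2) h r); split.
- by rewrite muln_gt0 d0 expn_gt0 q0.
- rewrite coprimeMl -coprime_modr chinese_modl// coprime_modr dh/=.
  by rewrite -coprime_modr chinese_modr// coprime_modr coprimeXl// prime_coprime.
- by rewrite dvdn_mulr.
- exact: chinese_modl.
move=> x xE n j' j'2.
have {}xE : x = r %[mod q ^ 2].
  have e : (q ^ 2 %| d * q ^ 2)%N by rewrite dvdn_mull.
  by rewrite -(modn_dvdm x e) xE (modn_dvdm _ e); exact: chinese_modr.
have xr : (q%:Z ^+ 2 %| x%:Z - r%:Z)%Z.
  by rewrite -eqz_mod_dvd -PoszX !modz_nat xE.
have Vx : (q%:Z ^+ 2 %| V x - V r)%Z.
  have -> : V x - V r = i%:Z * (x%:Z ^+ j - r%:Z ^+ j) by rewrite /V; ring.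
  by rewrite dvdz_mull// subrXX dvdz_mulr.
(* An equality would make q divide n, hence q^2 divide n^j' and the value at x, which agrees with
   the value at r modulo q^2. *)
apply/eqP => E.
have {}E : V x = (i' * n ^ j')%N by rewrite -E /V PoszM PoszX.
have : (q%:Z %| V x)%Z.
  rewrite -(subrK (V r) (V x)) rpredD//; apply: dvdz_trans Vx.
  by rewrite expr2 dvdz_mulr.
rewrite E dvdzE !absz_nat Euclid_dvdM// (negbTE qi')/= Euclid_dvdX// => /andP[qn _].
move: Vr2; rewrite -(subrK (V x) (V r)) rpredD//; first by rewrite -opprB rpredN.
rewrite E -PoszX dvdzE !absz_nat dvdn_mull//.
by apply: dvdn_trans (dvdn_exp2l n j'2); rewrite dvdn_exp2r.
Qed.

(** The progression is refined once for each member of the list; a refined class lies in the earlier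
    ones and keeps what they avoid. *)
Lemma avoid_shifted_powers (i j : nat) (L : seq (int * nat)) (d h : nat) :
    (0 < d)%N -> coprime d h -> (0 < i)%N -> (2 <= j)%N ->
    (forall y, y \in L -> y.1 != 0 /\ (0 < y.2)%N) ->
  exists d' h', [/\ (0 < d')%N, coprime d' h', (d %| d')%N, h' = h %[mod d] &
    forall x, x = h' %[mod d'] -> forall y, y \in L -> forall n j', (2 <= j')%N ->
      (i * x ^ j)%:Z + y.1 != (y.2 * n ^ j')%:Z].
Proof.
move=> d0 dh i0 j2; elim: L d h d0 dh => [|[c i'] L IH] d h d0 dh HL.
  by exists d, h; split.
have [c0 i'0] := HL (c, i') (mem_head _ _).
have [d1 [h1 [d10 dh1 dd1 h1h H1]]] := avoid_shifted_power d0 dh i0 j2 i'0 c0.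
have [|d2 [h2 [d20 dh2 dd2 h2h H2]]] := IH d1 h1 d10 dh1.
  by move=> y yL; apply: HL; rewrite inE yL orbT.
exists d2, h2; split => //; first exact: dvdn_trans dd2.
  by rewrite -h1h -(modn_dvdm h2 dd1) h2h modn_dvdm.
move=> x xh y; rewrite inE => /orP[/eqP ->|yL]; last exact: H2.
apply: H1; rewrite -(modn_dvdm x dd2) xh modn_dvdm//.
Qed.

(** * Isolated exponents and truncated series *)

Lemma lex_min (P : seq (nat * nat)) : P != [::] ->
  exists2 x, x \in P & forall y, y \in P ->
    (x.2 < y.2)%N \/ x.2 = y.2 /\ (x.1 <= y.1)%N.
Proof.
elim: P => // a [|b P] IH _.
  by exists a => [|y]; rewrite inE// => /eqP ->; right.
have [//|x xP xmin] := IH.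
have [ax|xa] : ((a.2 < x.2)%N \/ a.2 = x.2 /\ (a.1 <= x.1)%N) \/
    ((x.2 < a.2)%N \/ x.2 = a.2 /\ (x.1 <= a.1)%N) by lia.
  exists a; first exact: mem_head.
  move=> y; rewrite inE => /orP[/eqP ->|/xmin xy]; first by right.
  move: ax xy; move: a.1 a.2 x.1 x.2 y.1 y.2 => a1 a2 x1 x2 y1 y2; lia.
exists x; first by rewrite inE xP orbT.
by move=> y; rewrite inE => /orP[/eqP ->//|/xmin].
Qed.

(** Valuations at p give j' v = j with j <= j', so v = 1 and j' = j. Then n = p m with i' m^j = i
    and i <= i', which forces m = 1. *)
Lemma power_eq_lex (i j i' j' p n : nat) :
    prime p -> ~~ (p %| i)%N -> ~~ (p %| i')%N -> (0 < i)%N -> (0 < i')%N ->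
    (0 < j)%N -> (j < j')%N \/ j = j' /\ (i <= i')%N ->
    (i' * n ^ j' = i * p ^ j)%N ->
  [/\ i' = i, j' = j & n = p].
Proof.
move=> pp pi pi' i0 i'0 j0 jj E; have p0 := prime_gt0 pp.
have n0 : (0 < n)%N.
  have : (0 < i' * n ^ j')%N by rewrite E muln_gt0 i0 expn_gt0 p0.
  by rewrite muln_gt0 expn_gt0 => /andP[_ /orP[//|/eqP]]; lia.
have ndiv m : ~~ (p %| m)%N -> logn p m = 0%N.
  by move=> /negbTE pm; rewrite lognE pm !andbF.
have lp : logn p p = 1%N by rewrite logn_prime ?eqxx.
have := congr1 (logn p) E.
rewrite !lognM ?expn_gt0 ?n0 ?p0// (ndiv _ pi) (ndiv _ pi') !lognX lp muln1 !add0n.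
case L : (logn p n) => [|[|l]] jE; [lia| |nia].
have [m pm nE] := pfactor_coprime pp n0; rewrite L expn1 in nE.
have jj' : j' = j by lia.
have ii' : (i <= i')%N by lia.
move: E; rewrite jj' nE expnMn mulnA => /eqP.
rewrite eqn_pmul2r ?expn_gt0 ?p0// => /eqP E.
have m0 : (0 < m)%N by move: n0; rewrite nE muln_gt0 => /andP[].
have m1 : m = 1%N.
  case: (ltngtP m 1) => // m1; first lia.
  have : (1 < m ^ j)%N by rewrite -(exp1n j) ltn_exp2r.
  by move=> h; nia.
by split => //; [move: E; rewrite m1 exp1n muln1 | rewrite m1 mul1n].
Qed.

Lemma isolated_exponent (R : realType) (P : seq (nat * nat)) (x0 : nat * nat)
    (d h K : nat) :
    (forall x, x \in P -> (0 < x.1)%N /\ (2 <= x.2)%N) -> x0 \in P ->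
    (forall y, y \in P -> (x0.2 < y.2)%N \/ x0.2 = y.2 /\ (x0.1 <= y.1)%N) ->
    (0 < d)%N -> coprime d h ->
  exists p, [/\ prime p, p = h %[mod d], (K < p)%N & forall y n, y \in P ->
    (y.1 * n ^ y.2 <= x0.1 * p ^ x0.2 + K)%N ->
    (x0.1 * p ^ x0.2 <= y.1 * n ^ y.2 + K)%N -> y = x0 /\ n = p].
Proof.
move=> Ppos x0P x0min d0 dh; have [i0 j0] := Ppos _ x0P.
(* All nonzero shifts of size at most K, in both directions; the shift 0 is left to
   [power_eq_lex]. *)
pose L : seq (int * nat) := [seq (k.+1%:Z, y.1) | k <- iota 0 K, y <- P] ++
  [seq (- k.+1%:Z, y.1) | k <- iota 0 K, y <- P].
have LP y : y \in L -> y.1 != 0 /\ (0 < y.2)%N.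
  rewrite mem_cat => /orP[] /allpairsP[[k x] [_ /= /Ppos[? ?] ->]] /=; split=> //; lia.
have [d' [h' [d'0 dh' dd' hh' H]]] := avoid_shifted_powers d0 dh i0 j0 LP.
(* A prime above B exceeds K and divides none of the coefficients y.1. *)
pose B := (K + \max_(y <- P) y.1)%N.
have [p [pp Bp ph']] := dirichlet_primes R B d'0 dh'.
have yB y : y \in P -> (y.1 <= B)%N.
  move=> yP; apply: leq_trans (leq_addl _ _).
  by rewrite (big_rem y)//= leq_maxl.
exists p; split => //.
- by rewrite -hh' -(modn_dvdm p dd') ph' modn_dvdm.
- exact: leq_ltn_trans (leq_addr _ _) Bp.
have pdiv y : y \in P -> ~~ (p %| y.1)%N.
  move=> yP; apply/negP => /dvdn_leq; have [y0 _] := Ppos _ yP.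
  by have := yB _ yP; move=> h1 /(_ y0); lia.
move=> y n yP le1 le2; have [y0 y2] := Ppos _ yP.
case: (ltngtP (y.1 * n ^ y.2) (x0.1 * p ^ x0.2)) => [lt|lt|E].
- have [k [kK kE]] : exists k, (k < K)%N /\
      (y.1 * n ^ y.2 + k.+1 = x0.1 * p ^ x0.2)%N.
    by exists (x0.1 * p ^ x0.2 - y.1 * n ^ y.2).-1; lia.
  have yL : (- k.+1%:Z, y.1) \in L.
    rewrite mem_cat; apply/orP; right; apply/allpairsP; exists (k, y).
    by rewrite mem_iota add0n.
  by have := H p ph' _ yL n _ y2; rewrite /= -kE PoszD addrK eqxx.
- have [k [kK kE]] : exists k, (k < K)%N /\
      (x0.1 * p ^ x0.2 + k.+1 = y.1 * n ^ y.2)%N.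
    by exists (y.1 * n ^ y.2 - x0.1 * p ^ x0.2).-1; lia.
  have yL : (k.+1%:Z, y.1) \in L.
    rewrite mem_cat; apply/orP; left; apply/allpairsP; exists (k, y).
    by rewrite mem_iota add0n.
  by have := H p ph' _ yL n _ y2; rewrite /= -kE PoszD eqxx.
have [e1 e2 e3] := power_eq_lex pp (pdiv _ x0P) (pdiv _ yP) i0 y0 (ltnW j0) (x0min _ yP) E.
by split => //; move: e1 e2; case: (y) (x0) => [? ?] [? ?] /= -> ->.
Qed.

(** * Truncations of one series *)

Section SparseSeries.
Variables (R : realType) (b : nat) (S : set nat) (a : nat -> int) (i j M : nat).
Hypotheses (b2 : (2 <= b)%N) (i0 : (0 < i)%N) (j0 : (0 < j)%N)
  (aM : forall n, S n -> (`|a n|%N <= M)%N).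

Let z : R := 1 / b%:R.

Let zE : z = b%:R^-1. Proof. by rewrite /z div1r. Qed.

Let b0 : 0 < b%:R :> R. Proof. by rewrite ltr0n; lia. Qed.

Let z_gt0 : 0 < z. Proof. by rewrite zE invr_gt0. Qed.

Let z_le_half : 2 * z <= 1.
Proof. by rewrite zE ler_pdivrMr// mul1r ler_nat. Qed.

Let z_le1 : z <= 1.
Proof. by have := z_le_half; have := z_gt0; lra. Qed.

Let z_lt1 : z < 1.
Proof. by have := z_le_half; have := z_gt0; lra. Qed.

Let zX_ge0 n : 0 <= z ^+ n. Proof. by rewrite exprn_ge0// ltW. Qed.

Let expo n := (i * n ^ j)%N.

Lemma ltn_expo n : (expo n < expo n.+1)%N.
Proof. by rewrite /expo ltn_pmul2l// ltn_exp2r. Qed.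

Lemma leq_expo n : (n <= expo n)%N.
Proof. by elim: n => // n IH; exact: leq_ltn_trans IH (ltn_expo n). Qed.

Lemma sum_pow_expo_le T N :
  \sum_(0 <= n < N | (T <= expo n)%N) z ^+ expo n <= 2 * z ^+ T.
Proof.
have zS n : 2 * z ^+ n.+1 <= z ^+ n.
  by rewrite exprS mulrA ler_piMl.
(* The exponents increase strictly and 2 z <= 1, so each new term is paid for by the drop of the
   subtracted power; this carries the induction. *)
suff : \sum_(0 <= n < N | (T <= expo n)%N) z ^+ expo n <=
    2 * (z ^+ T - z ^+ maxn T (expo N)).
  by have := zX_ge0 (maxn T (expo N)); lra.
elim: N => [|N IH].
  by rewrite big_geq// mulr_ge0// subr_ge0 (ler_wiXn2l (ltW z_gt0))// leq_maxl.
rewrite big_mkcond big_nat_recr//= -big_mkcond/=.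
have lt := ltn_expo N; case: ifP => TN.
  apply: le_trans (lerD IH (lexx _)) _.
  rewrite (maxn_idPr TN) (maxn_idPr (leq_trans TN (ltnW lt))).
  have : z ^+ expo N.+1 <= z ^+ (expo N).+1.
    by rewrite (ler_wiXn2l (ltW z_gt0)).
  have := zS (expo N); lra.
rewrite addr0; apply: le_trans IH _; rewrite ler_pM2l// lerD2l lerN2.
rewrite (ler_wiXn2l (ltW z_gt0))//; lia.
Qed.

Let term n : R := if n \in S then (a n)%:~R * z ^+ expo n else 0.

Let norm_term n : `|term n| <= M%:R * z ^+ expo n.
Proof.
rewrite /term; case: ifPn => [nS|_]; last by rewrite normr0 mulr_ge0.
rewrite normrM (ger0_norm (zX_ge0 _)) ler_wpM2r//.
by rewrite -intr_norm -natr_absz ler_nat; apply: aM; rewrite inE in nS.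
Qed.

(** b^T times the part of the series at 1/b with exponents up to T. As n <= [expo n], the range n <=
    T misses none of these. *)
Definition sparse_head (T : nat) : int :=
  \sum_(0 <= n < T.+1 | (n \in S) && (expo n <= T)%N) a n * b%:Z ^+ (T - expo n).

Lemma sparse_head_extend T N : (T < N)%N -> sparse_head T =
  \sum_(0 <= n < N | (n \in S) && (expo n <= T)%N) a n * b%:Z ^+ (T - expo n).
Proof.
move=> TN; rewrite [RHS](@big_cat_nat _ _ _ T.+1)//= [X in _ = _ + X]big_nat_cond.
rewrite [X in _ = _ + X]big1 ?addr0// => n /andP[/andP[Tn _]] /andP[_ nT].
by have := leq_expo n; lia.
Qed.

(** With no exponent strictly between T and T', the remainder starts at z^T' and is dominated by a
    geometric series of ratio at most 1/2. *)
Lemma sparse_series_head T T' : (T < T')%N ->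
    (forall n, S n -> (T < expo n)%N -> (T' <= expo n)%N) ->
  `|b%:R ^+ T * sparse_series S a i j z - (sparse_head T)%:~R| <=
    2 * M%:R * (b%:R ^+ T * z ^+ T').
Proof.
move=> TT' gap; pose s N := \sum_(0 <= n < N) term n.
have sE : sparse_series S a i j z = limn s.
  rewrite /sparse_series; congr (limn _); apply/funext => N.
  by rewrite /s big_mkcond.
have bound T1 N (P : pred nat) : (forall n, P n -> term n != 0 -> (T1 <= expo n)%N) ->
    `|\sum_(0 <= n < N | P n) term n| <= 2 * M%:R * z ^+ T1.
  move=> H; apply: le_trans (ler_norm_sum _ _ _) _.
  apply: (@le_trans _ _ (\sum_(0 <= n < N | (T1 <= expo n)%N) M%:R * z ^+ expo n)).
    rewrite big_mkcond [leRHS]big_mkcond; apply: ler_sum => n _.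
    case: ifP => Pn; last by case: ifP => // _; rewrite mulr_ge0.
    have [->|t0] := eqVneq (term n) 0.
      by rewrite normr0; case: ifP => // _; rewrite mulr_ge0.
    by rewrite (H _ Pn t0).
  rewrite -mulr_sumr; have := ler_wpM2l (ler0n R M) (sum_pow_expo_le T1 N); lra.
have [cs _] : cvgn s /\ forall N, `|limn s - s N| <= 2 * M%:R * z ^+ N.
  apply: cvgn_of_rate => [N1 N2 N12|].
    rewrite /s [X in X - _](@big_cat_nat _ _ _ N1)//= [X in X - _]addrC addrK.
    have -> : \sum_(N1 <= n < N2) term n = \sum_(0 <= n < N2 | (N1 <= n)%N) term n.
      by rewrite (big_nat_widenl _ 0).
    by apply: bound => n Nn _; exact: leq_trans (leq_expo n).
  rewrite -[X in _ --> X](mulr0 (2 * M%:R)); apply: cvgM; first exact: cvg_cst.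
  by apply: cvg_expr; rewrite (ger0_norm (ltW z_gt0)).
have bz n : (n <= T)%N -> b%:R ^+ T * z ^+ n = b%:R ^+ (T - n) :> R.
  move=> nT; rewrite zE exprVn -{1}(subnK nT) exprD mulfK//.
  by rewrite expf_neq0// gt_eqF.
have part N : (T < N)%N -> `|b%:R ^+ T * s N - (sparse_head T)%:~R| <=
    2 * M%:R * (b%:R ^+ T * z ^+ T').
  move=> TN; have -> : (sparse_head T)%:~R =
      b%:R ^+ T * \sum_(0 <= n < N | (expo n <= T)%N) term n.
    rewrite (sparse_head_extend TN) rmorph_sum/= mulr_sumr.
    rewrite big_mkcond [RHS]big_mkcond; apply: eq_bigr => n _.
    rewrite /term; case: (n \in S) => /=; case: ifP => // nT; rewrite ?mulr0//.
    by rewrite mulrCA bz// rmorphM/= rmorphXn/=.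
  rewrite -mulrBr normrM ger0_norm ?exprn_ge0//.
  rewrite mulrCA ler_wpM2l ?exprn_ge0//.
  rewrite /s (bigID (fun n => (expo n <= T)%N))/= [X in X - _]addrC addrK.
  apply: bound => n; rewrite -ltnNge => Tn t0; apply: gap => //.
  by move: t0; rewrite /term; case: ifPn => [|_]; rewrite ?eqxx// inE.
have cT : b%:R ^+ T * s N @[N --> \oo] --> b%:R ^+ T * limn s.
  by apply: cvgM; [exact: cvg_cst | exact: cs].
rewrite sE -(cvg_lim _ cT)//.
have ccT : cvgn (fun N => b%:R ^+ T * s N) by apply/cvg_ex; eexists; exact: cT.
rewrite ler_distl; apply/andP; split.
  apply: limr_ge => //; exists T.+1 => // N /= TN.
  by have := part N TN; rewrite ler_distl => /andP[].
apply: limr_le => //; exists T.+1 => // N /= TN.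
by have := part N TN; rewrite ler_distl => /andP[].
Qed.

Lemma sparse_head_shift T K :
  sparse_head (T + K) = b%:Z ^+ K * sparse_head T +
    \sum_(0 <= n < (T + K).+1 | (n \in S) && (T < expo n <= T + K)%N)
      a n * b%:Z ^+ (T + K - expo n).
Proof.
rewrite (sparse_head_extend (_ : T < (T + K).+1)%N); last by lia.
rewrite {1}/sparse_head mulr_sumr.
rewrite [LHS](bigID (fun n => (expo n <= T)%N))/=; congr (_ + _).
  apply: eq_big => [n|n /andP[_ nT]]; first by case: (n \in S) => //=; lia.
  by rewrite mulrCA -exprD; congr (_ * _ ^+ _); lia.
by apply: eq_bigl => n; case: (n \in S) => //=; lia.
Qed.

End SparseSeries.

Lemma common_denominator (T : eqType) (s : seq T) (c : T -> rat) :
  exists2 D : int, D != 0 & exists k : T -> int, forall x, x \in s ->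
    c x * D%:~R = (k x)%:~R.
Proof.
elim: s => [|x s [D D0 [k kE]]]; first by exists 1 => //; exists (fun=> 0).
exists (denq (c x) * D); first by rewrite mulf_neq0 ?denq_neq0.
exists (fun y => if y == x then numq (c x) * D else denq (c x) * k y) => y.
rewrite inE; case: eqVneq => [-> _|_ /= ys].
  by rewrite !rmorphM/= numqE mulrA.
by rewrite !rmorphM/= mulrCA kE.
Qed.

(** * Linear independence *)

Lemma integral_combination_head (R : realType) (I : eqType) (r : seq I) (b K : nat)
    (S : I -> set nat) (a : I -> nat -> int) (i j M : I -> nat) (k : I -> int)
    (k0 : int) (T T' : nat) :
    (2 <= b)%N ->
    (forall x, x \in r -> [/\ (0 < i x)%N, (0 < j x)%N &
       forall n, S x n -> (`|a x n| <= M x)%N]) ->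
    k0%:~R + \sum_(x <- r) (k x)%:~R *
      sparse_series (S x) (a x) (i x) (j x) (1 / b%:R : R) = 0 ->
    (2 * \sum_(x <- r) `|k x| * M x <= K)%N -> (T + K <= T')%N -> (T < T')%N ->
    (forall x, x \in r -> forall n, S x n ->
       (T < i x * n ^ j x)%N -> (T' <= i x * n ^ j x)%N) ->
  \sum_(x <- r) k x * sparse_head b (S x) (a x) (i x) (j x) T = - (b%:Z ^+ T * k0).
Proof.
move=> b2 Hr rel HK TK TT' gap.
pose F x : R := sparse_series (S x) (a x) (i x) (j x) (1 / b%:R).
pose H x := sparse_head b (S x) (a x) (i x) (j x) T.
have b0 : 0 < b%:R :> R by rewrite ltr0n; lia.
apply/eqP; rewrite -subr_eq0 opprK; apply/eqP.
(* Z is an integer. By the relation it is minus the combination of the remainders, of size at most K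
   / b^(T' - T) <= K / b^K < 1. *)
set Z := _ + _; suff : (`|Z| < 1)%R by lia.
rewrite -(ltr_int R) intr_norm.
have -> : Z%:~R = - \sum_(x <- r) (k x)%:~R * (b%:R ^+ T * F x - (H x)%:~R) :> R.
  rewrite /Z rmorphD/= rmorphM/= rmorphXn/= rmorph_sum/=.
  have -> : k0%:~R = - \sum_(x <- r) (k x)%:~R * F x :> R.
    by apply/eqP; rewrite -subr_eq0 opprK rel.
  rewrite mulrN mulr_sumr -!sumrN -big_split/=; apply: eq_bigr => x _.
  by rewrite rmorphM/= -/(H x) pmulrn; ring.
rewrite normrN; apply: le_lt_trans (ler_norm_sum _ _ _) _.
apply: (@le_lt_trans _ _ (\sum_(x <- r)
    (`|k x| * M x)%N%:R * (2 * (b%:R ^+ T * (1 / b%:R) ^+ T')))).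
  rewrite big_seq [leRHS]big_seq; apply: ler_sum => x xr.
  have [i0 j0 aM] := Hr _ xr.
  have := @sparse_series_head R b (S x) (a x) (i x) (j x) (M x) b2 i0 j0 aM T T' TT' (gap x xr).
  move=> /(ler_wpM2l (normr_ge0 (k x)%:~R)); rewrite -normrM => /le_trans; apply.
  rewrite -intr_norm -natr_absz natrM; rewrite le_eqVlt; apply/orP; left; apply/eqP.
  by ring.
rewrite -mulr_suml -natr_sum mulrA -natrM mulnC.
have -> : b%:R ^+ T * (1 / b%:R) ^+ T' = (b%:R ^+ (T' - T))^-1 :> R.
  rewrite div1r exprVn -{1}(subnKC (ltnW TT')) exprD invfM mulrA mulfV ?mul1r//.
  by rewrite expf_neq0// gt_eqF.
rewrite (_ : 1%:~R = 1 :> R)// ltr_pdivrMr ?exprn_gt0// mul1r -natrX ltr_nat.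
have : (K < b ^ (T' - T))%N.
  by apply: leq_trans (ltn_expl K b2) _; rewrite leq_exp2l//; lia.
exact: leq_ltn_trans.
Qed.

Theorem theorem2 (R : realType) (b : nat) (d h : nat -> nat -> nat)
    (S : nat -> nat -> set nat) (a : nat -> nat -> nat -> int)
    (hb : (2 <= b)%N)
    (hd : forall i j : nat, (1 <= i)%N -> (2 <= j)%N -> (0 < d i j)%N)
    (hh : forall i j : nat, (1 <= i)%N -> (2 <= j)%N -> (0 < h i j)%N)
    (hdh : forall i j : nat, (1 <= i)%N -> (2 <= j)%N ->
       coprime (d i j) (h i j))
    (hS_pos : forall i j : nat, (1 <= i)%N -> (2 <= j)%N ->
       forall n : nat, S i j n -> (0 < n)%N)
    (hS_inf : forall i j : nat, (1 <= i)%N -> (2 <= j)%N ->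
       infinite_set (S i j))
    (hS_prime : forall i j : nat, (1 <= i)%N -> (2 <= j)%N ->
       forall p : nat, prime p -> p = h i j %[mod d i j] -> S i j p)
    (ha_neq0 : forall i j : nat, (1 <= i)%N -> (2 <= j)%N ->
       forall n : nat, S i j n -> a i j n != 0)
    (ha_bnd : forall i j : nat, (1 <= i)%N -> (2 <= j)%N ->
       exists M : int, forall n : nat, S i j n -> `|a i j n| <= M) :
  rat_lin_indep
    ([set (1 : R)] `|`
     [set x : R | exists i j : nat, [/\ (1 <= i)%N, (2 <= j)%N &
        x = sparse_series (S i j) (a i j) i j (1 / b%:R)]]).
Proof.
move=> s us sA c csum.
have [D D0 [k kE]] := common_denominator s c.
have kc x : x \in s -> k x = 0 -> c x = 0.
  move=> xs kx0; have := kE x xs; rewrite kx0 => /eqP.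
  by rewrite mulf_eq0 intr_eq0 (negbTE D0) orbF => /eqP.
have ksum : \sum_(x <- s) (k x)%:~R * x = 0 :> R.
  transitivity (D%:~R * \sum_(x <- s) ratr (c x) * x); last by rewrite csum mulr0.
  rewrite mulr_sumr big_seq [RHS]big_seq.
  apply: eq_bigr => x xs; rewrite mulrA; congr (_ * _).
  by have := congr1 (@ratr R) (kE x xs); rewrite rmorphM/= !ratr_int mulrC.
(* Several pairs may give the same number; one is chosen for each. Conversely a pair determines its
   number, so distinct numbers other than 1 get distinct pairs. *)
have [pr prE] : exists pr : R -> nat * nat, forall x, x \in s -> x != 1 ->
    [/\ (1 <= (pr x).1)%N, (2 <= (pr x).2)%N &
        x = sparse_series (S (pr x).1 (pr x).2) (a (pr x).1 (pr x).2)
              (pr x).1 (pr x).2 (1 / b%:R)].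
  suff /choice[pr prE] : forall x : R, exists y : nat * nat, x \in s -> x != 1 ->
    [/\ (1 <= y.1)%N, (2 <= y.2)%N &
        x = sparse_series (S y.1 y.2) (a y.1 y.2) y.1 y.2 (1 / b%:R)].
    by exists pr.
  move=> x; have [xs|xs] := boolP (x \in s); last by exists (0, 0)%N.
  have [->|[i [j [i0 j2 xE]]]] := sA x xs.
    by exists (0, 0)%N => _ /eqP.
  by exists (i, j).
pose r := [seq x <- s | (k x != 0) && (x != 1)].
have rP x : x \in r -> [/\ x \in s, k x != 0 & x != 1].
  by rewrite mem_filter => /andP[/andP[-> ->] ->].
pose k0 : int := \sum_(x <- s | x == 1) k x.
have rel : k0%:~R + \sum_(x <- r) (k x)%:~R * x = 0 :> R.
  rewrite -[RHS]ksum [RHS](bigID (fun x => x == 1))/=; congr (_ + _).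
    by rewrite rmorph_sum/=; apply: eq_bigr => x /eqP ->; rewrite mulr1.
  rewrite big_filter big_mkcond [RHS]big_mkcond; apply: eq_bigr => x _.
  by case: eqVneq => //= ->; case: ifP => //; rewrite mul0r.
(* With no series left, the relation only involves the coefficient of 1. *)
have [rN|rN] := eqVneq r [::].
  move=> x xs; apply: kc => //; apply/eqP/negPn/negP => kx.
  have x1 : x = 1.
    apply/eqP/negPn/negP => x1; have : x \in r by rewrite mem_filter kx x1.
    by rewrite rN.
  have := rel; rewrite rN big_nil addr0 => /eqP; rewrite intr_eq0 /k0.
  rewrite big_mkcond (bigD1_seq x)//= x1 eqxx big1 ?addr0 => [|y /negbTE ->//].
  by rewrite -x1 (negbTE kx).
exfalso.
have [x0 /mapP[r0 r0r ->] x0min] : exists2 x0, x0 \in [seq pr x | x <- r] &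
    forall y, y \in [seq pr x | x <- r] ->
      (x0.2 < y.2)%N \/ x0.2 = y.2 /\ (x0.1 <= y.1)%N.
  by apply: lex_min; case: (r) rN.
have prP x : x \in r -> (0 < (pr x).1)%N /\ (2 <= (pr x).2)%N.
  by move=> /rP[xs _ x1]; have [] := prE x xs x1.
have prF x : x \in r -> x = sparse_series (S (pr x).1 (pr x).2)
    (a (pr x).1 (pr x).2) (pr x).1 (pr x).2 (1 / b%:R).
  by move=> /rP[xs _ x1]; have [] := prE x xs x1.
have [M MP] : exists M : R -> nat, forall x, x \in r ->
    forall n, S (pr x).1 (pr x).2 n -> (`|a (pr x).1 (pr x).2 n| <= M x)%N.
  suff /choice[M MP] : forall x : R, exists m : nat, x \in r ->
    forall n, S (pr x).1 (pr x).2 n -> (`|a (pr x).1 (pr x).2 n| <= m)%N by exists M.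
  move=> x; have [xr|xr] := boolP (x \in r); last by exists 0%N.
  have [i0 j2] := prP x xr; have [m mP] := ha_bnd _ _ i0 j2.
  by exists `|m|%N => _ n /mP; lia.
pose K := (2 * \sum_(x <- r) `|k x| * M x)%N.
have [i0 j2] := prP _ r0r.
have [|p [pp ph Kp iso]] := @isolated_exponent R [seq pr x | x <- r] (pr r0)
    (d (pr r0).1 (pr r0).2) (h (pr r0).1 (pr r0).2) K _ (map_f pr r0r) x0min
    (hd _ _ i0 j2) (hdh _ _ i0 j2).
  by move=> _ /mapP[x xr ->]; exact: prP.
pose m0 := ((pr r0).1 * p ^ (pr r0).2)%N.
have pm0 : (p <= m0)%N by apply: leq_expo => //; lia.
have Sp : S (pr r0).1 (pr r0).2 p by apply: hS_prime.
(* The relation is cut at T and at m0: no exponent lies strictly between T and m0, nor among the K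
   integers after m0. As K < p <= m0, the subtraction is exact. *)
pose T := (m0 - K.+1)%N.
have TE : (T + K.+1 = m0)%N by rewrite /T subnK//; exact: leq_trans pm0.
have iso' x n : x \in r -> (T < (pr x).1 * n ^ (pr x).2)%N ->
    ((pr x).1 * n ^ (pr x).2 <= m0 + K)%N -> x = r0 /\ n = p.
  move=> xr Tn nm; have [||pE nE] := iso _ n (map_f pr xr); [exact: nm| |].
    by rewrite -/m0 -TE addnS -addSn leq_add2r.
  by split => //; rewrite (prF _ xr) (prF _ r0r) pE.
pose H x := sparse_head b (S (pr x).1 (pr x).2) (a (pr x).1 (pr x).2) (pr x).1 (pr x).2.
have heads T1 T2 : (T1 + K < T2)%N -> (forall x, x \in r ->
    forall n, S (pr x).1 (pr x).2 n -> (T1 < (pr x).1 * n ^ (pr x).2)%N ->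
      (T2 <= (pr x).1 * n ^ (pr x).2)%N) ->
  \sum_(x <- r) k x * H x T1 = - (b%:Z ^+ T1 * k0).
  move=> T12 gap; apply: (@integral_combination_head R _ r b K
    (fun x => S (pr x).1 (pr x).2) (fun x => a (pr x).1 (pr x).2)
    (fun x => (pr x).1) (fun x => (pr x).2) M k k0 T1 T2) => //.
  - by move=> x xr; have [? ?] := prP x xr; split => //; [lia | exact: MP].
  - rewrite -[RHS]rel; congr (_ + _); rewrite big_seq [RHS]big_seq.
    by apply: eq_bigr => x xr; rewrite -prF.
  - exact: ltnW.
  - by apply: leq_ltn_trans T12; exact: leq_addr.
have head1 : \sum_(x <- r) k x * H x T = - (b%:Z ^+ T * k0).
  apply: (heads T m0); first by rewrite -TE addnS.
  move=> x xr n _ Tn; rewrite leqNgt; apply/negP => nm.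
  have [|xE nE] := iso' x n xr Tn; first exact: leq_trans (ltnW nm) (leq_addr _ _).
  by move: nm; rewrite xE nE ltnn.
have head2 : \sum_(x <- r) k x * H x m0 = - (b%:Z ^+ m0 * k0).
  apply: (heads m0 (m0 + K).+1) => // x xr n _ mn; rewrite ltnNge; apply/negP => nm.
  have [|xE nE] := iso' x n xr _ nm; first by apply: leq_ltn_trans mn; rewrite -TE leq_addr.
  by move: mn; rewrite xE nE ltnn.
(* Between the two cuts the only new term is the one at n = p of the minimal pair, with factor
   b^0. *)
have shift x : x \in r -> H x m0 = b%:Z ^+ K.+1 * H x T +
    (if x == r0 then a (pr r0).1 (pr r0).2 p else 0).
  move=> xr; have [x_i x_j] := prP x xr.
  rewrite -[in LHS]TE /H sparse_head_shift//; last by lia.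
  congr (_ + _); rewrite TE.
  case: eqVneq => [->|xr0]; last first.
    rewrite big1// => n /andP[_ /andP[Tn nm]].
    have [xE _] := iso' x n xr Tn (leq_trans nm (leq_addr _ _)).
    by rewrite xE eqxx in xr0.
  rewrite big_mkcond (bigD1_seq p) ?iota_uniq ?mem_index_iota ?ltnS//=.
  have Tm : (T < m0)%N by rewrite -TE addnS ltnS leq_addr.
  rewrite (mem_set Sp) -/m0 Tm leqnn subnn expr0 mulr1 big1 ?addr0// => n np.
  case: ifP => // /andP[_ /andP[Tn nm]].
  have [_ nE] := iso' r0 n r0r Tn (leq_trans nm (leq_addr _ _)).
  by rewrite nE eqxx in np.
(* Subtracting b^(K+1) times the first head identity from the second cancels the constant k0 and
   leaves the isolated coefficient. *)
have : k r0 * a (pr r0).1 (pr r0).2 p = 0.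
  have := head2; rewrite big_seq.
  under eq_bigr => y yr do rewrite shift// mulrDr mulrCA.
  rewrite big_split/= -mulr_sumr -!big_seq head1 -TE exprD => E.
  have <- : \sum_(x <- r) k x * (if x == r0 then a (pr r0).1 (pr r0).2 p else 0) =
      k r0 * a (pr r0).1 (pr r0).2 p.
    rewrite (bigD1_seq r0) ?filter_uniq//= eqxx big1 ?addr0// => x /negbTE ->.
    by rewrite mulr0.
  move: E; move: (\sum_(x <- r) _) => X E.
  have -> : X = b%:Z ^+ K.+1 * - (b%:Z ^+ T * k0) + X + b%:Z ^+ K.+1 * (b%:Z ^+ T * k0).
    by ring.
  by rewrite E; ring.
have [_ kr0 _] := rP _ r0r; move/eqP; rewrite mulf_eq0 (negbTE kr0)/=.
by apply/negP; apply: ha_neq0.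
Qed.
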